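(* Let $(\Omega,\mathcal F,P)$ be a probability space with a filtration $(\mathcal F_t)_{t=0}^T$ such that every set in $\mathcal F_0$ has probability zero or one. For $t=0,\dots,T-1$, let $L_t:\mathbb R^N\times\mathbb R^{M^b}\times\mathbb R^{M^a}\times\Omega\to\overline{\mathbb R}$ be an $\mathcal F_{t+1}$-measurable lower bounded convex normal integrand, let $J:\mathbb R^N\times\Omega\to\overline{\mathbb R}$ be an $\mathcal F_T$-measurable lower bounded convex normal integrand, and let $$F_t(x,u^b,u^a,\omega)=A_{t+1}(\omega)x+B^b_{t+1}(\omega)u^b+B^a_{t+1}(\omega)u^a+W_{t+1}(\omega),$$ where $A_{t+1},B^b_{t+1},B^a_{t+1}$ are $\mathcal F_{t+1}$-measurable random matrices of appropriate dimensions and $W_{t+1}$ is an $\mathcal F_{t+1}$-measurable random vector in $\mathbb R^N$. Assume that, for every $t=1,\dots,T$ and almost every $\omega$, the set $$\{u\in\mathbb R^{M^a}\mid L_{t-1}^\infty(0,0,u,\omega)\le 0,\ B^a_t(\omega)u=0\}$$ is linear. Let $((J_t)_{t=0}^T,(\tilde Q_t)_{t=0}^{T-1})$ be a lower bounded convex normal solution of the Bellman equations $$J_T=J,$$ $$\tilde Q_t(x,u^b)=\inf_{u^a\in\mathbb R^{M^a}}\{L_t(x,u^b,u^a)+J_{t+1}(F_t(x,u^b,u^a))\},\qquad J_t(x)=\inf_{u^b\in\mathbb R^{M^b}}(E_t\tilde Q_t)(x,u^b),\qquad t=0,\dots,T-1.$$ Assume that $L_{t-1}$, $A_t$, $B^b_t$,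 $B^a_t$ and $W_t$ ($t=1,\dots,T$) depend on $\omega$ only through random variables $(\theta_{t-1},\theta_t,\eta_t)$, where $\theta=(\theta_t)_{t=0}^T$ is an adapted Markov process and $\eta=(\eta_t)_{t=0}^T$ is an adapted sequence of random variables such that each $\eta_t$ is independent of $\theta$ and of $\eta_s$ for $s\ne t$. If $J$ depends on $\omega$ only through $\theta_T$, then $J_t$ depends on $\omega$ only through $\theta_t$. In particular, if $L_{t-1}$, $A_t$, $B^b_t$, $B^a_t$, $W_t$ and $J$ are independent of $\theta$ (that is, they do not depend on $\theta$), then $J_t$ is deterministic.
   Context: $\overline{\mathbb R}=[-\infty,+\infty]$. A function $h:\mathbb R^n\times\Omega\to\overline{\mathbb R}$ is a ($\mathcal G$-measurable) normal integrand if $\omega\mapsto\operatorname{epi}h(\cdot,\omega)$ is a closed-valued ($\mathcal G$-)measurable set-valued mapping, i.e. $\{\omega\mid \operatorname{epi}h(\cdot,\omega)\cap O\ne\emptyset\}$ is measurable for every open $O\subset\mathbb R^{n}\times\mathbb R$; it is convex if $h(\cdot,\omega)$ is convex for each $\omega$. It is lower bounded if there is $m\in L^1$ with $h(x,\omega)\ge m(\omega)$ for all $x\in\mathbb R^n$ and almost every $\omega$. The argument $\omega$ is often suppressed. For a sub-$\sigma$-algebra $\mathcal G\subset\mathcal F$, the $\mathcal G$-conditional expectation $E^{\mathcal G}h$ of a lower bounded normal integrand $h$ is the unique $\mathcal G$-measurable normal integrand such that $(E^{\mathcal G}h)(x)=E[h(x)\mid\mathcal G]$ a.s. for every $\mathcal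 G$-measurable $\mathbb R^n$-valued random variable $x$. $E_t:=E^{\mathcal F_t}$. For a lower semicontinuous convex $g:\mathbb R^n\to\overline{\mathbb R}$, the recession function is $g^\infty(x)=\lim_{\alpha\to\infty}\frac{g(\bar x+\alpha x)-g(\bar x)}{\alpha}$, where $\bar x\in\operatorname{dom}g$. For a convex normal integrand $h$, $h^\infty(\cdot,\omega)$ is the recession function of $h(\cdot,\omega)$. A lower bounded convex normal solution of the Bellman equations consists of lower bounded convex normal integrands $J_t$ on $\mathbb R^N\times\Omega$ and $\tilde Q_t$ on $\mathbb R^N\times\mathbb R^{M^b}\times\Omega$ such that, for almost every $\omega$, the equations hold for all $t$ and all $x,u^b$. Adapted means that the time-$t$ component is $\mathcal F_t$-measurable for each $t$. The random variables $\theta_t$ and $\eta_t$ take values in Euclidean spaces. Given an $\mathbb R^d$-valued random variable $\xi$, a random variable $C$ depends on $\omega$ only through $\xi$ if $C=\hat C(\xi)$ a.s. for some measurable $\hat C$ on $\mathbb R^d$; a normal integrand $h$ on $\mathbb R^n\times\Omega$ depends on $\omega$ only through $\xi$ if there is a normal integrand $H:\mathbb R^n\times\mathbb R^d\to\overline{\mathbb R}$ ($\mathbb R^d$ with its Borel $\sigma$-algebra) such that, almost surely, $h(x,\omega)=H(x,\xi(\omega))$ for all $x\in\mathbb R^n$.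
   Formalization: The theorem adds that each η_{t+1} is independent of F_t and θ_{t+1} jointly, and takes θ Markov relative to (F_t); for an arbitrary filtration the claim fails, e.g. if F_1 already reveals η_2 and L_1=|x+η_2|. *)

(* Defs.v *)
From mathcomp Require Export all_boot all_order all_algebra.
From mathcomp Require Export all_classical all_reals all_analysis.
Export Order.TTheory GRing.Theory Num.Theory.
Export numFieldNormedType.Exports.

#[export] Set Implicit Arguments.
#[export] Unset Strict Implicit.
#[export] Unset Printing Implicit Defensive.

#[global] Open Scope classical_set_scope.
#[global] Open Scope ring_scope.
#[global] Open Scope ereal_scope.

(* A sigma-algebra on [S] is a [set_system S]; a sub-sigma-algebra of the
   ambient one is such a system included in [measurable]. *)

Definition borel (E : topologicalType) : set_system E := <<s @open E >>.
Arguments borel : clear implicits.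

Definition measurable_wrt (S : Type) (E : topologicalType)
    (G : set_system S) (f : S -> E) : Prop :=
  forall B, borel E B -> G (f @^-1` B).

Definition sigma_of (S : Type) (E : topologicalType) (f : S -> E) :
    set_system S :=
  preimage_set_system setT f (borel E).

Definition filtration (d : measure_display) (Omega : measurableType d)
    (T : nat) (F : nat -> set_system Omega) : Prop :=
  [/\ forall t, (t <= T)%N -> sigma_algebra setT (F t),
      forall t, (t <= T)%N -> F t `<=` measurable &
      forall s t, (s <= t <= T)%N -> F s `<=` F t].

Definition adapted (S : Type) (T : nat) (F : nat -> set_system S)
    (E : nat -> topologicalType) (X : forall t, S -> E t) : Prop :=
  forall t, (t <= T)%N -> measurable_wrt (F t) (X t).

Definition independent (d : measure_display) (Omega : measurableType d)
    (R : realType) (P : probability Omega R) (G H : set_system Omega) : Prop :=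
  forall A B, G A -> H B -> P (A `&` B) = P A * P B.

(* [Z] is a version of E[Y | G].  The definition is meant for [Y] with
   integrable negative part.  Since [+oo - +oo] is [-oo] in [\bar R], equality
   of the integrals over [Omega] then makes the negative part of [Z] integrable
   too, so that [\int] is the usual integral on both sides. *)
Definition is_cond_expectation (d : measure_display) (Omega : measurableType d)
    (R : realType) (P : probability Omega R) (G : set_system Omega)
    (Y Z : Omega -> \bar R) : Prop :=
  measurable_wrt G Z /\
  forall A, G A -> \int[P]_(w in A) Z w = \int[P]_(w in A) Y w.

Section integrands.
Context {R : realType}.

(* [R^o] is [R] as a module over itself. *)
Definition epi (E : Type) (g : E -> \bar R) : set (E * R^o) :=
  [set z | g z.1 <= (z.2)%:E].

Definition normal_integrand (S : Type) (E : topologicalType)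
    (G : set_system S) (h : E -> S -> \bar R) : Prop :=
  (forall w, closed (epi (h ^~ w))) /\
  (forall O : set (E * R^o), open O ->
     G [set w | epi (h ^~ w) `&` O !=set0]).

Definition convex_integrand (S : Type) (E : lmodType R)
    (h : E -> S -> \bar R) : Prop :=
  forall w, convex_set (epi (h ^~ w)).

(* At a lower semicontinuous convex [g], finite on its nonempty domain, the
   limit exists and does not depend on the point that [xget] selects. *)
Definition recession (E : lmodType R) (g : E -> \bar R) (x : E) : \bar R :=
  let xbar := xget 0%R [set y | g y < +oo] in
  lim (((g (xbar + a *: x)%R - g xbar) * (a^-1)%:E) @[a --> +oo%R]).

Definition linear_set (E : lmodType R) (A : set E) : Prop :=
  A 0%R /\ forall (a : R) (u v : E), A u -> A v -> A (a *: u + v)%R.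

Context {d : measure_display} {Omega : measurableType d}.
Variable P : probability Omega R.

Definition lower_bounded (E : Type) (h : E -> Omega -> \bar R) : Prop :=
  exists2 m : Omega -> R, P.-integrable setT (EFin \o m) &
    \forall w \ae P, forall x, (m w)%:E <= h x w.

Definition lb_convex_normal_integrand (E : normedModType R)
    (G : set_system Omega) (h : E -> Omega -> \bar R) : Prop :=
  [/\ normal_integrand G h, convex_integrand h & lower_bounded h].

(* [k] is E^G h; for lower bounded normal [h] it exists and is unique up to
   indistinguishability. *)
Definition is_cond_integrand (E : topologicalType) (G : set_system Omega)
    (h k : E -> Omega -> \bar R) : Prop :=
  normal_integrand G k /\
  forall X : Omega -> E, measurable_wrt G X ->
    is_cond_expectation P G (fun w => h (X w) w) (fun w => k (X w) w).

Definition rv_depends_through (E D : topologicalType)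
    (C : Omega -> E) (xi : Omega -> D) : Prop :=
  exists2 Chat : D -> E, measurable_wrt (borel D) Chat &
    \forall w \ae P, C w = Chat (xi w).

Definition integrand_depends_through (E D : topologicalType)
    (h : E -> Omega -> \bar R) (xi : Omega -> D) : Prop :=
  exists2 H : E -> D -> \bar R, normal_integrand (borel D) H &
    \forall w \ae P, forall x, h x w = H x (xi w).

Definition deterministic_integrand (E : Type)
    (h : E -> Omega -> \bar R) : Prop :=
  exists g : E -> \bar R, \forall w \ae P, forall x, h x w = g x.

(* Markov property relative to the filtration: for Borel [B],
   P(theta_{t+1} \in B | F_t) = P(theta_{t+1} \in B | theta_t). *)
Definition markov (T : nat) (F : nat -> set_system Omega)
    (E : nat -> topologicalType) (theta : forall t, Omega -> E t) : Prop :=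
  forall t, (t < T)%N -> forall B, borel (E t.+1) B ->
    exists Z : Omega -> \bar R,
      is_cond_expectation P (sigma_of (theta t))
        (EFin \o \1_(theta t.+1 @^-1` B)) Z /\
      is_cond_expectation P (F t) (EFin \o \1_(theta t.+1 @^-1` B)) Z.

(* Each [eta t] is independent of the whole family formed by [theta] and the
   other [eta s], not merely of each of its members. *)
Definition independent_noise (T : nat) (D E : nat -> topologicalType)
    (theta : forall t, Omega -> D t) (eta : forall t, Omega -> E t) : Prop :=
  forall t, (t <= T)%N ->
    independent P (sigma_of (eta t))
      <<s \bigcup_(s in [set s | (s <= T)%N]) sigma_of (theta s) `|`
          \bigcup_(s in [set s | (s <= T)%N /\ s != t]) sigma_of (eta s) >>.

(* [F t] and [theta t.+1] do not reveal [eta t.+1].  If [F t] is generated by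
   [theta s] and [eta s], [s <= t], this follows from [independent_noise]; for
   a larger filtration it does not. *)
Definition nonanticipative_noise (T : nat) (F : nat -> set_system Omega)
    (D E : nat -> topologicalType)
    (theta : forall t, Omega -> D t) (eta : forall t, Omega -> E t) : Prop :=
  forall t, (t < T)%N ->
    independent P (sigma_of (eta t.+1))
      <<s F t `|` sigma_of (theta t.+1) >>.

Section bellman.
Variables N Mb Ma : nat.

Definition dynamics
    (A : nat -> Omega -> 'M[R]_(N, N)) (Bb : nat -> Omega -> 'M[R]_(N, Mb))
    (Ba : nat -> Omega -> 'M[R]_(N, Ma)) (W : nat -> Omega -> 'cV[R]_N)
    (t : nat) (x : 'cV[R]_N) (ub : 'cV[R]_Mb) (ua : 'cV[R]_Ma) (w : Omega) :
    'cV[R]_N :=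
  (A t.+1 w *m x + Bb t.+1 w *m ub + Ba t.+1 w *m ua + W t.+1 w)%R.

(* [EQ t] is E_t Q_t.  By lower boundedness no term of the sum is [-oo] for
   almost every [w], so the value of [+oo - oo] is immaterial. *)
Definition lb_convex_normal_bellman_solution (T : nat)
    (F : nat -> set_system Omega)
    (L : nat -> 'cV[R]_N * 'cV[R]_Mb * 'cV[R]_Ma -> Omega -> \bar R)
    (dyn : nat -> 'cV[R]_N -> 'cV[R]_Mb -> 'cV[R]_Ma -> Omega -> 'cV[R]_N)
    (J : 'cV[R]_N -> Omega -> \bar R)
    (Jt : nat -> 'cV[R]_N -> Omega -> \bar R)
    (Qt : nat -> 'cV[R]_N * 'cV[R]_Mb -> Omega -> \bar R) : Prop :=
  [/\ forall t, (t <= T)%N -> lb_convex_normal_integrand measurable (Jt t),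
      forall t, (t < T)%N -> lb_convex_normal_integrand measurable (Qt t) &
      exists EQ : nat -> 'cV[R]_N * 'cV[R]_Mb -> Omega -> \bar R,
        (forall t, (t < T)%N -> is_cond_integrand (F t) (Qt t) (EQ t)) /\
        \forall w \ae P,
          [/\ forall x, Jt T x w = J x w,
              forall t x ub, (t < T)%N ->
                Qt t (x, ub) w =
                ereal_inf (range (fun ua : 'cV[R]_Ma =>
                  L t (x, ub, ua) w + Jt t.+1 (dyn t x ub ua w) w)) &
              forall t x, (t < T)%N ->
                Jt t x w =
                ereal_inf (range (fun ub : 'cV[R]_Mb => EQ t (x, ub) w))]].

End bellman.
End integrands.

(* Main.v *)
(* The step from [J_{t+1}] to [J_t] never leaves lower semicontinuous integrands,
   and such an integrand [h] is [h(z) = sup {inf_B h | z \in B}] over a countable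
   base of balls [B]. Conversely [z |-> sup {m_B | z \in B}] is a normal integrand
   for any measurable [m_B], by compactness of closed balls. So [h] depends on
   [omega] only through [xi] iff each [inf_B h] is a.e. a Borel function of [xi].
   Taking infima of sums preserves this; for [E_t Q_t], let [e_B] be
   [E[inf_B Q_t | F_t]], which is [sigma(theta_t)]-measurable by the Markov
   property and the independence of [eta_{t+1}]. Measurable selection and Fatou's
   lemma give [E_t Q_t = sup {e_B | z \in B}] almost surely.
   The deterministic case is the case of a constant process [theta]. *)

Require Import Defs.
From mathcomp Require Import lra measurable_realfun simple_functions.

(** * Sigma-algebras *)

(** The equations hold only almost surely, so dependence on [xi] is tested in [ae_sigma P xi], the
    sets that agree off a null set with the preimage of a Borel set. This is a sigma-algebra, but it
    may contain sets that are not measurable. Integrands are therefore followed in several set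
    systems at once, the ambient one and [F t] for integrals, [ae_sigma] for dependence; hence
    lemmas for an arbitrary sigma-algebra [G], and measurability ([inf_measurable]) kept apart from
    lower semicontinuity.

    A partial infimum is harmless: its infimum over an open set is an infimum over a cylinder,
    attained or not. The obstacle is the sum of [L t] and [Jt t.+1] along the dynamics, whose
    infimum over a given ball is not a function of the infima of the summands; it is recovered on
    compact sets from approximate solutions at scales 1/(k+1).

    Conditioning is reduced to nonnegative integrands. The integrable bound in [lower_bounded] need
    not be a function of [xi], so the shift is built from the infimum of the integrand itself. *)

Section sigma_logic.
Variables (S : Type) (G : set_system S).
Hypothesis HG : sigma_algebra setT G.
Implicit Types (A B : S -> Prop).

Lemma sigmaT : G setT.
Proof. by case: HG => G0 /(_ _ G0) + _; rewrite setD0. Qed.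

Lemma sigma_not A : G [set w | A w] -> G [set w | ~ A w].
Proof. by case: HG => _ GC _ /GC; rewrite setTD. Qed.

Lemma sigma_ex (I : countType) (A : I -> S -> Prop) :
  (forall i, G [set w | A i w]) -> G [set w | exists i, A i w].
Proof.
case: HG => G0 _ GU GA.
rewrite (_ : mkset _ = \bigcup_k
    (if unpickle k is Some i then [set w | A i w] else set0)); last first.
  apply/seteqP; split=> [w [i Aiw]|w [k _]] /=.
    by exists (pickle i) => //; rewrite pickleK.
  by case: unpickle => // i Aiw; exists i.
by apply: GU => k; case: unpickle.
Qed.

Lemma sigma_all (I : countType) (A : I -> S -> Prop) :
  (forall i, G [set w | A i w]) -> G [set w | forall i, A i w].
Proof.
move=> GA; rewrite (_ : mkset _ = [set w | ~ exists i, ~ A i w]).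
  by apply/sigma_not/sigma_ex => i; exact: sigma_not.
apply/seteqP; split=> w /=; first by move=> Aw [i]; exact.
by move=> nA i; apply: contrapT => nAi; apply: nA; exists i.
Qed.

Lemma sigma_cst (p : Prop) : G [set _ | p].
Proof.
have [hp|hp] := pselect p.
  by rewrite (_ : mkset _ = setT) ?predeqE//; exact: sigmaT.
by rewrite (_ : mkset _ = set0) ?predeqE//; case: HG.
Qed.

Lemma sigma_or A B : G [set w | A w] -> G [set w | B w] ->
  G [set w | A w \/ B w].
Proof.
move=> GA GB.
rewrite (_ : mkset _ = [set w | exists b : bool, if b then A w else B w]).
  by apply: sigma_ex => -[].
apply/seteqP; split=> w /=; first by case; [exists true|exists false].
by move=> [[]]; [left|right].
Qed.

Lemma sigma_and A B : G [set w | A w] -> G [set w | B w] ->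
  G [set w | A w /\ B w].
Proof.
move=> GA GB.
rewrite (_ : mkset _ = [set w | forall b : bool, if b then A w else B w]).
  by apply: sigma_all => -[].
apply/seteqP; split=> w /=; first by move=> [? ?] [].
by move=> AB; split; [exact: (AB true)|exact: (AB false)].
Qed.

Lemma sigma_imp (p : Prop) A : (p -> G [set w | A w]) ->
  G [set w | p -> A w].
Proof.
move=> GA; have [hp|hp] := pselect p.
  rewrite (_ : mkset _ = [set w | A w]); first exact: GA.
  by apply/seteqP; split=> w /=; [exact|move=> ? ?].
rewrite (_ : mkset _ = setT); first exact: sigmaT.
by apply/seteqP; split=> w //=.
Qed.

End sigma_logic.

Section ereal_measurability.
Context {R : realType} (S : Type) (G : set_system S).
Hypothesis HG : sigma_algebra setT G.

(** Strict sublevel sets suit infima: an infimum is below [r] exactly when some value is, attained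
    or not. *)
Definition emeas (f : S -> \bar R) := forall r : R, G [set w | f w < r%:E].

Lemma ereal_lt_rat (x y : \bar R) : x < y ->
  exists q : rat, x < (ratr q)%:E < y.
Proof.
have Q (a b : R) : (a < b)%R -> exists q : rat, a%:E < (ratr q)%:E < b%:E.
  by move=> /rat_in_itvoo[q]; rewrite in_itv/= => ?; exists q; rewrite !lte_fin.
case: x => [x||]; case: y => [y||]//= xy.
- by apply: Q; rewrite -lte_fin.
- have [|q /andP[xq _]] := Q x (x + 1)%R; first by rewrite ltrDl.
  by exists q; rewrite xq ltry.
- have [|q /andP[_ qy]] := Q (y - 1)%R y; first by rewrite ltrBlDr ltrDl.
  by exists q; rewrite qy ltNyr.
- by exists 0%R; rewrite ltNyr ltry.
Qed.

Lemma emeas_le f : emeas f -> forall r : R, G [set w | f w <= r%:E].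
Proof.
move=> mf r; rewrite (_ : mkset _ = [set w | forall q : rat,
    (r < ratr q)%R -> f w < (ratr q)%:E]).
  by apply: (sigma_all HG) => q; apply: (sigma_imp HG) => _; exact: mf.
apply/seteqP; split=> w /= fw.
  by move=> q rq; apply: (le_lt_trans fw); rewrite lte_fin.
rewrite leNgt; apply/negP => /ereal_lt_rat[q /andP[rq qf]].
have /fw : (r < ratr q)%R by rewrite -lte_fin.
by move=> /(lt_trans qf); rewrite ltxx.
Qed.

Lemma emeas_lte2 f g : emeas f -> emeas g -> G [set w | f w < g w].
Proof.
move=> mf mg; rewrite (_ : mkset _ = [set w | exists q : rat,
    f w < (ratr q)%:E /\ ~ (g w <= (ratr q)%:E)]).
  apply: (sigma_ex HG) => q; apply: (sigma_and HG); first exact: mf.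
  exact/(sigma_not HG)/emeas_le.
apply/seteqP; split=> w /=.
  by move=> /ereal_lt_rat[q /andP[fq qg]]; exists q; split=> //; rewrite leNgt qg.
by move=> [q [fq /negP]]; rewrite -ltNge; exact: lt_trans.
Qed.

End ereal_measurability.
Arguments emeas {R S} G f.

Section ae_preimage.
Context {R : realType} {d : measure_display} {Omega : measurableType d}.
Variables (P : probability Omega R) (D : Type) (xi : Omega -> D).
Variable B : set_system D.

(* Preimages under [xi] up to [P]-negligible modifications: depending on
   [omega] only through [xi] is measurability with respect to this system. *)
Definition ae_preimage : set_system Omega :=
  [set A | exists2 U, B U & \forall w \ae P, A w <-> U (xi w)].

Lemma ae_preimage_sigma : sigma_algebra setT B -> sigma_algebra setT ae_preimage.
Proof.
move=> HB; split.
- by exists set0; [case: HB|exact: aeW].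
- move=> A [U BU AU]; exists (~` U); first by rewrite -setTD; case: HB => _ + _; exact.
  by apply: filterS AU => w [AU UA]; rewrite setTD; split; exact: contra_not.
- move=> A /(_ _)/cid2-/all_sig2[U BU AU]; exists (\bigcup_k U k).
    by case: HB => _ _; exact.
  move/ae_foralln: AU; apply: filterS => w AU.
  by split=> -[k _ ?]; exists k => //; exact/AU.
Qed.

Lemma ae_preimage_ae (A A' : set Omega) : ae_preimage A ->
  (\forall w \ae P, A w <-> A' w) -> ae_preimage A'.
Proof.
move=> [U BU AU] AA'; exists U => //; apply: filterS2 AU AA' => w ? ?; tauto.
Qed.

(* [inf {q | w \in B_q}] recovers [f w] since [f w < q <-> xi w \in B_q]. *)
Lemma ae_preimage_factor (f : Omega -> \bar R) : sigma_algebra setT B ->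
  emeas ae_preimage f ->
  exists2 g : D -> \bar R, emeas B g & \forall w \ae P, f w = g (xi w).
Proof.
move=> HB mf.
have /(_ _)/cid2-/all_sig2[U BU fU] (q : rat) := mf (ratr q).
exists (fun s => ereal_inf [set (ratr q)%:E | q in [set q | U q s]]).
  move=> r; rewrite (_ : mkset _ = [set s | exists q : rat, (ratr q)%:E < r%:E /\ U q s]).
    apply: (sigma_ex HB) => q; apply: (sigma_and HB); last exact: BU.
    exact: (sigma_cst HB ((ratr q)%:E < r%:E)).
  apply/seteqP; split=> s /=.
    by move=> /ereal_inf_lt[_ [q Uq <-] qr]; exists q.
  by move=> [q [qr Uq]]; apply: le_lt_trans qr; apply: ereal_inf_lbound; exists q.
have : \forall w \ae P, forall k : nat,
    if unpickle k is Some q then f w < (ratr q)%:E <-> U q (xi w) else True.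
  by apply/ae_foralln => k; case: unpickle => [q|]; [exact: fU|exact: aeW].
apply: filterS => w fUw.
have {fUw}fUw (q : rat) : f w < (ratr q)%:E <-> U q (xi w).
  by have := fUw (pickle q); rewrite pickleK.
apply/eqP; rewrite eq_le; apply/andP; split.
  by apply: le_ereal_inf_tmp => _ [q /fUw/ltW + <-].
rewrite leNgt; apply/negP => /ereal_lt_rat[q /andP[fq]].
by apply/negP; rewrite -leNgt; apply: ereal_inf_lbound; exists q => //; exact/fUw.
Qed.

End ae_preimage.

(** * Normal integrands and countable bases *)

Lemma compact_seq_cluster (E : topologicalType) (K : set E) (u : nat -> E) :
  compact K -> (forall n, K (u n)) ->
  exists2 p, K p & forall V, nbhs p V -> forall n0, exists2 n, (n0 <= n)%N & V (u n).
Proof.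
move=> cK Ku.
have [|p [Kp up]] := cK (u @ \oo) _; first by exists 0%N => // n _; exact: Ku.
exists p => // V pV n0.
have [|//|_ [[n /= n0n <-] Vn]] := up (u @` [set n | (n0 <= n)%N]) V.
  by exists n0 => // n n0n; exists n.
by exists n.
Qed.

Section base.
Context {R : realType} {E : normedModType R}.

Definition dense_seq (x : nat -> E) :=
  forall z (e : R), (0 < e)%R -> exists i, ball (x i) e z.

(** The index codes a centre and a radius 1/(j+1). A code that decodes to nothing is read as (0, 0),
    so every [n] gives a ball. *)
Definition base_ball (x : nat -> E) (n : nat) : set E :=
  let ij := odflt (0, 0)%N (unpickle n) in ball (x ij.1) (ij.2.+1%:R^-1)%R.

Lemma base_ball_open x n : open (base_ball x n).
Proof. exact: ball_open. Qed.

Lemma base_ball_pickle x i j : base_ball x (pickle (i, j)) = ball (x i) (j.+1%:R^-1)%R.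
Proof. by rewrite /base_ball pickleK. Qed.

Variable x : nat -> E.
Hypothesis dx : dense_seq x.

Lemma small_inv (e : R) : (0 < e)%R -> exists j, (j.+1%:R^-1 < e)%R.
Proof.
move=> e0; exists (Num.trunc e^-1).
rewrite invf_plt ?posrE//.
by apply: truncnS_gt.
Qed.

(** The closure is controlled as well, so that in a proper space [V] contains a compact
    neighbourhood of [z] taken from a countable family. *)
Lemma base_ball_nbhs z (V : set E) : nbhs z V ->
  exists2 n, base_ball x n z & closure (base_ball x n) `<=` V.
Proof.
move=> /nbhs_ballP[e /= e0 eV].
have [|j je] := @small_inv (e / 2)%R; first by rewrite divr_gt0.
have [|i iz] := @dx z (j.+1%:R^-1)%R; first by rewrite invr_gt0.
exists (pickle (i, j)); rewrite base_ball_pickle// => y.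
(* With r = 1/(j+1), a closure point is within e/2 - r of the ball, hence within r + r + (e/2 - r) <
   e of [z]. *)
move=> /(_ (ball y ((e / 2) - j.+1%:R^-1)%R))[].
  by apply: nbhsx_ballx; rewrite subr_gt0.
move=> t [it yt]; apply: eV.
have : ball z (j.+1%:R^-1 + j.+1%:R^-1 + ((e / 2) - j.+1%:R^-1))%R y.
  apply: (@ball_triangle _ _ t); last exact: ball_sym.
  by apply: (@ball_triangle _ _ (x i)) => //; exact: ball_sym.
have le_e (u : R) : (u < e / 2 -> u + u + (e / 2 - u) <= e)%R by lra.
exact/le_ball/le_e.
Qed.

Lemma base_ballP z (V : set E) : nbhs z V ->
  exists2 n, base_ball x n z & base_ball x n `<=` V.
Proof.
by move=> /base_ball_nbhs[n ? nV]; exists n => // y /subset_closure; exact: nV.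
Qed.

End base.

Definition proper_space {R : realType} (E : normedModType R) :=
  forall (c : E) (r : R), compact (closure (ball c r)).

Section epigraph.
Context {R : realType} {E : normedModType R}.
Implicit Types g : E -> \bar R.

Lemma closed_epiP g : closed (epi g) <-> forall a : R, open [set z | a%:E < g z].
Proof.
split=> [cg a|og].
  rewrite (_ : mkset _ = ~` ((fun z : E => (z, a : R^o)) @^-1` epi g)).
    apply: closed_openC; apply: (closed_comp _ cg) => z _.
    apply: (@cvg_pair _ _ _ (nbhs z) (nbhs z) (nbhs (a : R^o))).
      exact: cvg_id.
    exact: cvg_cst.
  by apply/seteqP; split=> z /=; rewrite /epi/= ltNge => /negP.
rewrite -[epi g]setCK; apply: open_closedC; rewrite openE => -[z b] /= /negP.
(* A level strictly between [b] and [g z] separates: [g] stays above it near [z], and heights near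
   [b] stay below it. *)
rewrite -ltNge => /ereal_lt_rat[q /andP[bq qg]].
exists ([set z | (ratr q)%:E < g z], [set c : R^o | (c < ratr q)%R]).
  split; first exact: (open_nbhs_nbhs (conj (og _) qg)).
  by apply: lt_nbhsl; rewrite -lte_fin.
move=> [y c] [/= qy cq]; rewrite /epi/=; apply/negP; rewrite -ltNge.
by apply: lt_trans qy; rewrite lte_fin.
Qed.

Variable x : nat -> E.
Hypothesis dx : dense_seq x.

Lemma lsc_sup_inf g z : (forall a : R, open [set z | a%:E < g z]) ->
  g z = ereal_sup [set ereal_inf [set g y | y in base_ball x n]
                  | n in [set n | base_ball x n z]].
Proof.
move=> og; apply/eqP; rewrite eq_le; apply/andP; split.
  rewrite leNgt; apply/negP => /ereal_lt_rat[q /andP[sq qg]].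
  have [n nz nq] := base_ballP dx (open_nbhs_nbhs (conj (og (ratr q)) qg)).
  move: sq; apply/negP; rewrite -leNgt.
  apply: (@le_trans _ _ (ereal_inf [set g y | y in base_ball x n])).
    by apply: le_ereal_inf_tmp => _ [y /nq/ltW ? <-].
  by apply: ereal_sup_ubound; exists n.
apply: ge_ereal_sup => _ [n nz <-].
by apply: ereal_inf_lbound; exists z.
Qed.

End epigraph.

Section integrand_measurability.
Context {R : realType} {E : normedModType R} {S : Type}.
Variable G : set_system S.
Hypothesis HG : sigma_algebra setT G.
Implicit Types h : E -> S -> \bar R.

(** For a normal integrand this is the hitting condition on [epi] for products of [U] with []-oo,
    r[]. It is the form in which measurability is carried through the recursion. *)
Definition inf_measurable h := forall (U : set E) (r : R), open U ->
  G [set w | exists2 z, U z & h z w < r%:E].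

Lemma normal_inf_measurable h : normal_integrand G h -> inf_measurable h.
Proof.
move=> [_ nh] U r oU.
have := nh [set z : E * R^o | U z.1 /\ (z.2 < r)%R] _.
rewrite (_ : [set w | _ `&` _ !=set0] = [set w | exists2 z, U z & h z w < r%:E]).
  apply; apply: openI; first exact: (open_comp (fun z _ => cvg_fst)).
  by apply: (@open_comp _ _ snd [set b : R^o | (b < r)%R]);
    [move=> z _; exact: cvg_snd|exact: open_lt].
apply/seteqP; split=> w /=.
  by move=> [[z b] [/= hb [Uz br]]]; exists z => //; apply: le_lt_trans hb _.
move=> [z Uz /ereal_lt_rat[q /andP[hq qr]]]; exists (z, ratr q); split=> /=.
  exact: ltW.
by split=> //; rewrite -lte_fin.
Qed.

Lemma inf_measurable_emeas h (U : set E) : open U -> inf_measurable h ->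
  emeas G (fun w => ereal_inf [set h z w | z in U]).
Proof.
move=> oU mh r.
rewrite (_ : mkset _ = [set w | exists2 z, U z & h z w < r%:E]); first exact: mh.
apply/seteqP; split=> w /=; first by move=> /ereal_inf_lt[_ [z Uz <-]]; exists z.
by move=> [z Uz]; apply: le_lt_trans; apply: ereal_inf_lbound; exists z.
Qed.

Variable x : nat -> E.
Hypothesis dx : dense_seq x.

(* For lower semicontinuous [h] evaluation is a supremum of infima over balls. *)
Lemma inf_measurable_comp h (X : S -> E) :
  (forall w (a : R), open [set z | a%:E < h z w]) ->
  inf_measurable h -> measurable_wrt G X -> emeas G (fun w => h (X w) w).
Proof.
move=> oh mh mX r.
suff le_meas : forall a : R, G [set w | ~ (h (X w) w <= a%:E)].
  rewrite (_ : mkset _ = [set w | exists q : rat, (ratr q < r)%R /\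
      ~ ~ (h (X w) w <= (ratr q)%:E)]).
    apply: (sigma_ex HG) => q; apply: (sigma_and HG); last exact: sigma_not.
    exact: (sigma_cst HG (ratr q < r)%R).
  apply/seteqP; split=> w /=.
    move=> /ereal_lt_rat[q /andP[hq qr]]; exists q; split=> //.
    by apply; exact: ltW.
  by move=> [q [qr /contrapT hq]]; apply: le_lt_trans hq _.
move=> a; rewrite (_ : mkset _ = [set w | exists n, base_ball x n (X w) /\
   a%:E < ereal_inf [set h z w | z in base_ball x n]]).
  apply: (sigma_ex HG) => n; apply: (sigma_and HG).
    by apply: mX; apply: sub_sigma_algebra; exact: base_ball_open.
  apply: (emeas_lte2 HG); last exact: (inf_measurable_emeas (@base_ball_open _ _ _ _)).
  by move=> b; exact: (sigma_cst HG (a%:E < b%:E)).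
apply/seteqP; split=> w /=.
  move=> /negP; rewrite -ltNge (lsc_sup_inf dx (X w) (oh w)).
  by move=> /ereal_sup_gt[_ [n nX <-] ?]; exists n.
move=> [n [nX an]]; apply/negP; rewrite -ltNge; apply: lt_le_trans an _.
by apply: ereal_inf_lbound; exists (X w).
Qed.

End integrand_measurability.

Section sup_integrand.
Context {R : realType} {E : normedModType R} {S : Type}.
Variables (B : nat -> set E) (m : nat -> S -> \bar R).

Definition sup_integrand (z : E) (w : S) : \bar R :=
  ereal_sup [set m n w | n in [set n | B n z]].

Hypothesis oB : forall n, open (B n).

Lemma sup_integrand_le z w (r : \bar R) :
  sup_integrand z w <= r <-> forall n, B n z -> m n w <= r.
Proof.
split=> [kr n nz|mr]; last by apply: ge_ereal_sup => _ [n nz <-]; exact: mr.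
by apply: le_trans kr; apply: ereal_sup_ubound; exists n.
Qed.

Lemma sup_integrand_lsc w (a : R) : open [set z | a%:E < sup_integrand z w].
Proof.
rewrite (_ : mkset _ = \bigcup_(n in [set n | a%:E < m n w]) B n).
  by apply: bigcup_open => n _.
apply/seteqP; split=> z /=; first by move=> /ereal_sup_gt[_ [n nz <-] ?]; exists n.
by move=> [n /= an nz]; apply: lt_le_trans an _; apply: ereal_sup_ubound; exists n.
Qed.

Variable G : set_system S.
Hypothesis HG : sigma_algebra setT G.
Hypothesis mm : forall n, emeas G (m n).

(* By compactness it suffices to satisfy, for each [l], the constraints
   [m n w <= r] with [n < l] and [B n z]; these involve finitely many [n]. *)
Lemma sup_integrand_compact (K : set E) (r : R) : compact K ->
  G [set w | exists2 z, K z & sup_integrand z w <= r%:E].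
Proof.
move=> cK.
rewrite (_ : mkset _ = [set w | forall l : nat, exists s : seq nat,
    (exists2 z, K z & forall n, (n < l)%N -> B n z -> n \in s) /\
    forall n, n \in s -> m n w <= r%:E]).
  apply: (sigma_all HG) => l; apply: (sigma_ex HG) => s; apply: (sigma_and HG).
    exact: (sigma_cst HG (exists2 z, _ & _)).
  apply: (sigma_all HG) => n; apply: (sigma_imp HG) => _.
  exact: (emeas_le HG).
apply/seteqP; split=> w /=.
  move=> [z Kz /sup_integrand_le zr] l.
  exists [seq n <- iota 0 l | `[<B n z>]]; split.
    exists z => // n nl nz.
    by rewrite mem_filter mem_iota add0n nl !andbT; exact/asboolP.
  by move=> n; rewrite mem_filter => /andP[/asboolP nz _]; exact: zr.
move=> rw.
have /(_ _)/cid2-/all_sig2[u Ku ur] (l : nat) :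
    exists2 z, K z & forall n, (n < l)%N -> B n z -> m n w <= r%:E.
  have [s [[z Kz zs] sr]] := rw l; exists z => // n nl nz.
  exact/sr/zs.
have [p Kp up] := compact_seq_cluster cK Ku.
exists p => //; apply/sup_integrand_le => n np.
(* Rank [n.+1] guarantees [n < l], so the constraint of index [n] is among those imposed on
   [u l]. *)
have [l nl lB] := up _ (open_nbhs_nbhs (conj (oB n) np)) n.+1.
exact: ur lB.
Qed.

(** A point of the epigraph in [O] can be moved up to a rational height, and its neighbourhood
    shrunk to a closed base ball. This leaves countably many conditions on compact sets, each
    covered by [sup_integrand_compact]. *)
Lemma sup_integrand_normal (x : nat -> E) : dense_seq x -> proper_space E ->
  normal_integrand G sup_integrand.
Proof.
move=> dx pE; split=> [w|O oO]; first exact/closed_epiP/sup_integrand_lsc.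
rewrite (_ : mkset _ = [set w | exists n, exists q : rat,
    (forall z, closure (base_ball x n) z -> O (z, ratr q)) /\
    exists2 z, closure (base_ball x n) z & sup_integrand z w <= (ratr q)%:E]).
  apply: (sigma_ex HG) => n; apply: (sigma_ex HG) => q; apply: (sigma_and HG).
    exact: (sigma_cst HG (forall z, _ -> _)).
  by apply: sup_integrand_compact; exact: pE.
apply/seteqP; split=> w /=; last first.
  by move=> [n [q [nO [z nz zq]]]]; exists (z, ratr q); split=> //; exact: nO.
move=> [[z b] [/= zb Ozb]].
have [[V1 V2] /= [zV1 bV2] VO] := open_nbhs_nbhs (conj oO Ozb).
have [n nz nV] := base_ball_nbhs dx zV1.
have /nbhs_ballP[e /= e0 eV] := bV2.
have /rat_in_itvoo[q /[!in_itv]/= /andP[bq qe]] : (b < b + e)%R by rewrite ltrDl.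
exists n, q; split.
  move=> y /nV yV; apply: VO; split=> //=; apply: eV.
  by rewrite /ball/= ltr0_norm ?subr_lt0// opprB ltrBlDl.
exists z; first exact: subset_closure.
by apply: le_trans zb _; rewrite lee_fin ltW.
Qed.

End sup_integrand.

(** * Measurable selection *)

Lemma measurable_wrt_open (S : Type) (E : topologicalType) (G : set_system S)
    (X : S -> E) : sigma_algebra setT G ->
  (forall U, open U -> G (X @^-1` U)) -> measurable_wrt G X.
Proof.
move=> HG GX B; apply: (smallest_sub (X := [set A | G (X @^-1` A)])) => //=.
split => [|A GA|A GA] /=.
- by rewrite preimage_set0; case: HG.
- by rewrite setTD -preimage_setC; exact: (sigma_not HG (A := X @^-1` A)).
- by rewrite preimage_bigcup; case: HG => _ _; exact.
Qed.

Section first_index.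
Variable p : nat -> Prop.

Definition first_index : nat :=
  if pselect (exists i, `[<p i>]) is left e then ex_minn e else 0%N.

(** This logical form makes the event that the first index is [i] measurable by the closure rules
    above. The second alternative is the default value 0. *)
Lemma first_indexE i : first_index = i <->
  (p i /\ forall j, (j < i)%N -> ~ p j) \/ (i = 0%N /\ forall j, ~ p j).
Proof.
rewrite /first_index; case: pselect => [e|ne]; last first.
  split=> [<-|[[pi _]|[-> //]]].
    by right; split=> // j pj; apply: ne; exists j; exact/asboolP.
  by exfalso; apply: ne; exists i; exact/asboolP.
case: ex_minnP => k /asboolP pk kmin; split=> [<-|[[pi imin]|[_ np]]].
- left; split=> // j jk /asboolP/kmin; by rewrite leqNgt jk.
- apply/eqP; rewrite eqn_leq kmin; last exact/asboolP.
  by rewrite leqNgt; apply/negP => /imin.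
- by exfalso; exact: (np _ pk).
Qed.

Lemma first_indexP : (exists i, p i) -> p first_index.
Proof.
move=> [i pi]; have := (first_indexE first_index).1 erefl.
by case=> [[]//|[_ /(_ i)]].
Qed.

End first_index.

Lemma closure_ball_double {R : realType} {E : normedModType R} (c : E) (r s : R) :
  (r < s)%R -> closure (ball c r) `<=` ball c s.
Proof.
move=> rs y /(_ (ball y (s - r)%R))[].
  by apply: nbhsx_ballx; rewrite subr_gt0.
move=> t [ct /ball_sym yt].
by have := ball_triangle ct yt; rewrite addrCA subrr addr0.
Qed.

Section selection.
Context {R : realType} {E : normedModType R} {S : Type}.
Variables (G : set_system S) (x : nat -> E) (C : S -> set E).
Hypotheses (HG : sigma_algebra setT G) (dx : dense_seq x) (pE : proper_space E).
Hypothesis mC : forall U, open U -> G [set w | exists2 z, U z & C w z].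

Let rad (n : nat) : R := (n.+1%:R^-1)%R.

Let rad_gt0 n : (0 < rad n)%R. Proof. by rewrite invr_gt0. Qed.

(** Indices are listed latest first; the radius of a ball is read off from the length of the tail
    behind its index. *)
Fixpoint nested_balls (s : seq nat) : set E :=
  if s is i :: s' then ball (x i) (rad (size s')) `&` nested_balls s' else setT.

Lemma nested_balls_open s : open (nested_balls s).
Proof.
elim: s => [|i s IHs] /=; first exact: openT.
by apply: openI => //; exact: ball_open.
Qed.

(** Greedy search: the new index is the least one whose ball, cut with the earlier balls, still
    meets [C w]. *)
Fixpoint approx_index (n : nat) (w : S) : seq nat :=
  if n is n'.+1 then
    let s := approx_index n' w in
    first_index (fun i => exists2 z, nested_balls (i :: s) z & C w z) :: s
  else [::].

Let center n w := x (head 0%N (approx_index n.+1 w)).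

Lemma size_approx_index n w : size (approx_index n w) = n.
Proof. by elim: n => //= n ->. Qed.

Lemma approx_index_measurable n s : G [set w | approx_index n w = s].
Proof.
elim: n s => [|n IHn] s /=; first exact: (sigma_cst HG ([::] = s)).
case: s => [|i s].
  by rewrite (_ : mkset _ = set0); [case: HG|apply/seteqP; split].
pose H j w := exists2 z, nested_balls (j :: s) z & C w z.
have GH j : G [set w | H j w] by apply: mC; exact: nested_balls_open.
rewrite (_ : mkset _ = [set w | approx_index n w = s /\
   ((H i w /\ forall j, (j < i)%N -> ~ H j w) \/ (i = 0%N /\ forall j, ~ H j w))]).
  apply: (sigma_and HG) => //; apply: (sigma_or HG); apply: (sigma_and HG) => //.
  - apply: (sigma_all HG) => j; apply: (sigma_imp HG) => _; exact: (sigma_not HG).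
  - exact: (sigma_cst HG (i = 0%N)).
  - by apply: (sigma_all HG) => j; exact: (sigma_not HG).
apply/seteqP; split=> w /=.
  by move=> -[+ sE]; rewrite sE => /first_indexE.
by move=> [sE Hw]; congr cons => //; rewrite sE; apply/first_indexE.
Qed.

Lemma nested_balls_approx_le n m w : (n <= m)%N ->
  nested_balls (approx_index m w) `<=` nested_balls (approx_index n w).
Proof.
elim: m => [|m IHm]; first by rewrite leqn0 => /eqP ->.
rewrite leq_eqVlt => /orP[/eqP -> //|]; rewrite ltnS => /IHm.
by move=> nm z [_]; exact: nm.
Qed.

Lemma nested_balls_approx n w : C w !=set0 ->
  exists2 z, nested_balls (approx_index n w) z & C w z.
Proof.
move=> [z0 Cz0]; elim: n => [|n [z nz Cz]]; first by exists z0.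
rewrite [approx_index _ _]/=.
apply: (@first_indexP (fun i => exists2 z,
  nested_balls (i :: approx_index n w) z & C w z)).
have [i iz] := dx z (rad_gt0 n).
by exists i, z => //; split=> //; rewrite size_approx_index.
Qed.

Lemma nested_balls_center n w z :
  nested_balls (approx_index n.+1 w) z -> ball (center n w) (rad n) z.
Proof. by case; rewrite size_approx_index. Qed.

Let limit_point w : set E :=
  [set p | forall n, closure (ball (center n w) (rad n)) p].

Lemma limit_point_neq0 w : limit_point w !=set0.
Proof.
have [nC|nC] := pselect (C w !=set0); last first.
  (* If [C w] is empty, every index takes the default value 0 and all balls share the centre
     [x 0]. *)
  exists (x 0%N) => n; apply: subset_closure.
  rewrite /center /= (_ : first_index _ = 0%N); first exact: ballxx.
  apply/first_indexE; right; split=> // j [z _ Cz]; apply: nC; by exists z.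
have /(_ _)/cid2-/all_sig2[u nu Cu] (n : nat) := nested_balls_approx n.+1 nC.
(* Compactness of the first closed ball plays the part of completeness: points of [C w] in ever
   deeper balls accumulate in all of them. *)
have [|p _ up] := @compact_seq_cluster _ _ u (@pE (center 0 w) (rad 0)).
  move=> n; apply/subset_closure/nested_balls_center.
  exact: (nested_balls_approx_le (n := 1) (m := n.+1)).
exists p => n V pV; have [m nm Vm] := up V pV n.
exists (u m); split=> //; apply/nested_balls_center.
exact: (nested_balls_approx_le (n := n.+1) (m := m.+1)).
Qed.

(** The Kuratowski and Ryll-Nardzewski construction. The sets [C w] are not assumed closed, so the
    limit of the nested balls lies only in the closure. *)
Lemma measurable_selection : exists2 X : S -> E, measurable_wrt G X &
  forall w, C w !=set0 -> closure (C w) (X w).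
Proof.
have /(_ _)/cid-/all_sig[X XP] (w : S) := limit_point_neq0 w.
have dist w n : ball (center n w) (2 * rad n)%R (X w).
  apply: closure_ball_double (XP w n); rewrite ltr_pMl ?ltr1n//.
have near_X w V : nbhs (X w) V ->
    exists n, ball (center n w) (2 * rad n)%R `<=` V.
  move=> /nbhs_ballP[e /= e0 eV].
  have [|n ne] := @small_inv _ (e / 4)%R; first by rewrite divr_gt0.
  exists n => y cy; apply: eV; have := ball_triangle (ball_sym (dist w n)) cy.
  apply: le_ball; rewrite -/(rad n) in ne.
  have le_e (u : R) : (u < e / 4 -> 2 * u + 2 * u <= e)%R by lra.
  exact: le_e.
exists X.
  apply: measurable_wrt_open => // U oU.
  (* [X w] is in [U] exactly when some ball of doubled radius around a centre is contained in [U].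
     This involves [w] only through a finite list of indices, of which there are countably many; the
     ball whose index heads [s] has rank [(size s).-1]. *)
  rewrite (_ : _ @^-1` _ = [set w | exists s : seq nat,
     approx_index (size s) w = s /\ (0 < size s)%N /\
     ball (x (head 0%N s)) (2 * rad (size s).-1)%R `<=` U]).
    apply: (sigma_ex HG) => s; apply: (sigma_and HG).
      exact: approx_index_measurable.
    exact: (sigma_cst HG (_ /\ _ `<=` _)).
  apply/seteqP; split=> w /=.
    move=> UX; have [n nU] := near_X w U (open_nbhs_nbhs (conj oU UX)).
    by exists (approx_index n.+1 w); rewrite size_approx_index.
  move=> [[|i s] [sE [// _ sU]]]; apply: sU; have := dist w (size s).
  by rewrite /center (sE : approx_index (size s).+1 w = i :: s).
move=> w nC V /near_X[n nV].
have [z nz Cz] := nested_balls_approx n.+1 nC.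
exists z; split=> //; apply/nV/(le_ball _ (nested_balls_center nz)).
by rewrite ler_pMl ?ler1n.
Qed.

End selection.

(** * Sums and compositions *)

Section sum_integrand.
Context {R : realType} {E0 E1 : normedModType R} {S : Type}.
Variables (G : set_system S) (N : set S) (x : nat -> E0) (y : nat -> E1).
Variables (g : E0 -> S -> \bar R) (h : E1 -> S -> \bar R) (f : E0 -> S -> E1).
Hypotheses (HG : sigma_algebra setT G) (GN : G N).
Hypotheses (dx : dense_seq x) (dy : dense_seq y) (pE : proper_space E0).
Hypotheses (og : forall w (a : R), open [set z | a%:E < g z w])
           (oh : forall w (a : R), open [set z | a%:E < h z w]).
Hypotheses (mg : inf_measurable G g) (mh : inf_measurable G h).
Hypotheses (cf : forall w, continuous (f ^~ w))
           (mf : forall z u (e : R), G [set w | ball u e (f z w)]).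
Hypotheses (g_gt : forall w, N w -> forall z, -oo < g z w)
           (h_gt : forall w, N w -> forall z, -oo < h z w).

Let rad (n : nat) : R := (n.+1%:R^-1)%R.

Let rad_gt0 n : (0 < rad n)%R. Proof. by rewrite invr_gt0. Qed.

(** A solution of [g z w + h (f z w) w <= r] with [z] in [K], blurred at scale 1/(k+1) and expressed
    with countable data. The point of [K], the point where [g] is small and the point where [h] is
    small may all differ; they merge only as [k] grows. *)
Let approximable (K : set E0) (r : R) (w : S) (k : nat) :=
  exists ij : nat * nat, exists ab : rat * rat,
    [/\ (ratr ab.1 + ratr ab.2 <= r + rad k :> R)%R,
        K `&` ball (x ij.1) (rad k) !=set0,
        exists2 z, ball (x ij.1) (rad k) z & g z w < (ratr ab.1)%:E,
        exists2 u, ball (y ij.2) (rad k) u & h u w < (ratr ab.2)%:E &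
        ball (y ij.2) (rad k) (f (x ij.1) w)].

Lemma approximable_measurable K r k : G [set w | approximable K r w k].
Proof.
apply: (sigma_ex HG) => -[i j]; apply: (sigma_ex HG) => -[a b] /=.
rewrite (_ : mkset _ = [set w |
  ((ratr a + ratr b <= r + rad k :> R)%R /\ K `&` ball (x i) (rad k) !=set0) /\
  (exists2 z, ball (x i) (rad k) z & g z w < (ratr a)%:E) /\
  (exists2 u, ball (y j) (rad k) u & h u w < (ratr b)%:E) /\
  ball (y j) (rad k) (f (x i) w)]).
  apply: (sigma_and HG); first exact: (sigma_cst HG (_ /\ _)).
  apply: (sigma_and HG); first exact/mg/ball_open.
  apply: (sigma_and HG); first exact/mh/ball_open.
  exact: mf.
by apply/seteqP; split=> w /= => [[]|[[? ?] [? [? ?]]]].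
Qed.

Lemma approximable_sum (K : set E0) (r : R) w z : N w -> K z ->
  g z w + h (f z w) w <= r%:E -> forall k, approximable K r w k.
Proof.
move=> Nw Kz zr k.
(* Halves of [rad k] are spent on two pairs: the distances from [y j] to [f z w] and on to
   [f (x i) w], and the excesses of the rational levels over the two summands. *)
have k2 : (0 < rad k / 2)%R by rewrite divr_gt0.
have [j jf] := dy (f z w) k2.
have /nbhs_ballP[e /= e0 ef] :
    nbhs z [set t | ball (f z w) (rad k / 2)%R (f t w) /\ ball z (rad k) t].
  apply: filterI; last exact: nbhsx_ballx.
  by apply: cf; exact: nbhsx_ballx.
have [i /ball_sym/ef[fi zi]] := dx z e0.
have := g_gt Nw z; have := h_gt Nw (f z w).
have zz : ball (x i) (rad k) z by exact: ball_sym.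
case gz : (g z w) zr => [u| |]; case hz : (h (f z w) w) => [v| |]// uvr _ _.
have /rat_in_itvoo[a /[!in_itv]/= /andP[ua ae]] : (u < u + rad k / 2)%R.
  by rewrite ltrDl.
have /rat_in_itvoo[b /[!in_itv]/= /andP[vb be]] : (v < v + rad k / 2)%R.
  by rewrite ltrDl.
exists (i, j), (a, b); split=> /=.
- rewrite -EFinD lee_fin in uvr; move: (rad k) ae be uvr => e1; lra.
- by exists z.
- by exists z => //; rewrite gz lte_fin.
- exists (f z w); last by rewrite hz lte_fin.
  by apply: le_ball jf; rewrite ler_pdivrMr// ler_pMr// ler1n.
- by rewrite [rad k]splitr; exact: ball_triangle jf fi.
Qed.

Lemma lte_sum_split (r : R) (s t : \bar R) : -oo < s -> -oo < t ->
  r%:E < s + t -> exists ab : R * R,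
    [/\ ab.1%:E < s, ab.2%:E < t & (r < ab.1 + ab.2)%R].
Proof.
have fin_y (b : R) (s' : \bar R) : b%:E < s' -> exists ab : R * R,
    [/\ ab.1%:E < +oo, ab.2%:E < s' & (r < ab.1 + ab.2)%R].
  move=> bs; exists (r - b + 1, b)%R; split => //=; first exact: ltry.
  by rewrite addrAC subrK ltrDl.
have lt_fin (s' : \bar R) : -oo < s' -> exists b : R, b%:E < s'.
  by move=> /ereal_lt_rat[q /andP[_ ?]]; exists (ratr q).
case: s t => [s| |] [t| |] //= s0 t0.
- rewrite -EFinD lte_fin => rst.
  (* Each summand gives up a third of the gap to [r], so a third of it remains. *)
  exists (s - (s + t - r) / 3, t - (s + t - r) / 3)%R.
  by split; rewrite ?lte_fin/=; lra.
- have [b bs] := lt_fin _ s0; have [[a' b'] [? ? ?]] := fin_y _ _ bs.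
  by exists (b', a'); split=> //; rewrite /= addrC.
- by have [b bt] := lt_fin _ t0; have := fin_y _ _ bt.
- by have [b bt] := lt_fin _ t0; have := fin_y _ _ bt.
Qed.

(** If the sum exceeded [r] at a cluster point [p], levels a < g and b < h with r < a + b would
    persist near [p] and near its image. For large [k] the blurred solution lies there, so its
    rational levels add up to more than a + b, yet to at most r + 1/(k+1). *)
Lemma sum_approximable (K : set E0) (r : R) w : N w -> compact K ->
  (forall k, approximable K r w k) ->
  exists2 z, K z & g z w + h (f z w) w <= r%:E.
Proof.
move=> Nw cK /(_ _)/cid-/all_sig[ij]/(_ _)/cid-/all_sig[ab]H.
have /(_ _)/cid2-/all_sig2[c Kc ic] (k : nat) :
    exists2 c, K c & ball (x (ij k).1) (rad k) c.
  by have [_ [c [Kc ic]] _ _ _] := H k; exists c.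
have [p Kp cp] := compact_seq_cluster cK Kc.
exists p => //; rewrite leNgt; apply/negP => /lte_sum_split.
move=> /(_ (g_gt Nw p) (h_gt Nw (f p w)))[[a b] [/= ap bp rab]].
have /nbhs_ballP[e2 /= e20 e2h] := open_nbhs_nbhs (conj (oh w b) bp).
have /nbhs_ballP[e /= e0 eP] :
    nbhs p [set t | a%:E < g t w /\ ball (f p w) (e2 / 2)%R (f t w)].
  apply: filterI; first exact: (open_nbhs_nbhs (conj (og w a) ap)).
  by apply: cf; apply: nbhsx_ballx; rewrite divr_gt0.
(* With 1/(k+1) below e/4 and e2/4, a start within e/2 or e2/2 can be followed by two more jumps of
   that size without leaving the balls of radius [e] and [e2]. The last bound contradicts the
   levels. *)
have m0 : (0 < Num.min (e / 4) (Num.min (e2 / 4) (a + b - r)))%R.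
  by rewrite !lt_min !divr_gt0//= subr_gt0.
have [k0 k0m] := small_inv m0.
have [|k k0k kp] := cp (ball p (e / 2)%R) _ k0.
  by apply: nbhsx_ballx; rewrite divr_gt0.
have : (rad k <= rad k0)%R by rewrite lef_pV2 ?posrE// ler_nat ltnS.
move=> /le_lt_trans/(_ k0m); rewrite !lt_min => /and3P[ke ke2 kab].
have [abr _ [z iz za] [u ju ub] jf] := H k.
have := ball_triangle kp (ball_sym (ic k)) => pxi.
have pz := ball_triangle pxi iz.
have {pxi}[_ fi] : a%:E < g (x (ij k).1) w /\
    ball (f p w) (e2 / 2)%R (f (x (ij k).1) w).
  by apply/eP/(le_ball _ pxi); move: (rad k) ke => ?; lra.
have {pz}[az _] : a%:E < g z w /\ ball (f p w) (e2 / 2)%R (f z w).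
  by apply/eP/(le_ball _ pz); move: (rad k) ke => ?; lra.
have pu := ball_triangle (ball_triangle fi (ball_sym jf)) ju.
have {pu}bu : b%:E < h u w.
  by apply/e2h/(le_ball _ pu); move: (rad k) ke2 => ?; lra.
have := lt_trans az za; have := lt_trans bu ub; rewrite !lte_fin.
by move: (rad k) kab abr => ?; lra.
Qed.

(** Restriction to [N] keeps -oo out of the sum. A value below [r] is at most a rational below [r]
    on some closed base ball inside [U], and there solvability is a countable conjunction of
    approximate solvability. *)
Lemma sum_inf_measurable (U : set E0) (r : R) : open U ->
  G [set w | N w /\ exists2 z, U z & g z w + h (f z w) w < r%:E].
Proof.
move=> oU.
rewrite (_ : mkset _ = [set w | N w /\ exists nq : nat * rat,
    ((ratr nq.2 < r)%R /\ closure (base_ball x nq.1) `<=` U) /\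
    forall k, approximable (closure (base_ball x nq.1)) (ratr nq.2) w k]).
  apply: (sigma_and HG) => //; apply: (sigma_ex HG) => -[n q] /=.
  apply: (sigma_and HG); first exact: (sigma_cst HG (_ /\ _)).
  apply: (sigma_all HG) => k; exact: approximable_measurable.
apply/seteqP; split=> w /= [Nw].
  move=> [z Uz zr]; split=> //.
  have [q /andP[zq qr]] := ereal_lt_rat zr.
  have [n nz nU] := base_ball_nbhs dx (open_nbhs_nbhs (conj oU Uz)).
  exists (n, q); split; first by split; rewrite // -lte_fin.
  by apply: approximable_sum (ltW zq) => //; exact: subset_closure.
move=> [[n q] /= [[qr nU] /(sum_approximable Nw)[|z /nU Uz zq]]].
  exact: pE.
by split=> //; exists z => //; apply: le_lt_trans zq _; rewrite lte_fin.
Qed.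

End sum_integrand.

(** * Dependence on a random variable *)

Lemma borel_sigma (E : topologicalType) : sigma_algebra setT (borel E).
Proof. exact: smallest_sigma_algebra. Qed.

Lemma continuous_measurable_wrt (D E : topologicalType) (f : D -> E) :
  continuous f -> measurable_wrt (borel D) f.
Proof.
move=> cf; apply: measurable_wrt_open; first exact: borel_sigma.
by move=> U oU; apply: sub_sigma_algebra; apply: open_comp.
Qed.

Section depends_through.
Context {R : realType} {d : measure_display} {Omega : measurableType d}.
Variable P : probability Omega R.

Definition ae_sigma (D : topologicalType) (xi : Omega -> D) : set_system Omega :=
  ae_preimage P xi (borel D).

Lemma ae_sigmaP (D : topologicalType) (xi : Omega -> D) :
  sigma_algebra setT (ae_sigma xi).
Proof. exact/ae_preimage_sigma/borel_sigma. Qed.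

Lemma ae_sigma_comp (D D' : topologicalType) (xi : Omega -> D') (phi : D' -> D) :
  measurable_wrt (borel D') phi -> ae_sigma (phi \o xi) `<=` ae_sigma xi.
Proof. by move=> mphi A [U bU AU]; exists (phi @^-1` U) => //; exact: mphi. Qed.

Variables (E : normedModType R) (D : topologicalType).
Variables (h : E -> Omega -> \bar R) (xi : Omega -> D).

Lemma depends_inf_measurable :
  integrand_depends_through P h xi -> inf_measurable (ae_sigma xi) h.
Proof.
move=> [H nH hH] U r oU; exists [set s | exists2 z, U z & H z s < r%:E].
  exact: (normal_inf_measurable nH).
apply: filterS hH => w hH /=.
by split=> -[z Uz hz]; exists z; rewrite ?hH// -hH.
Qed.

Lemma inf_measurable_depends (x : nat -> E) : dense_seq x -> proper_space E ->
  (forall w (a : R), open [set z | a%:E < h z w]) ->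
  inf_measurable (ae_sigma xi) h -> integrand_depends_through P h xi.
Proof.
move=> dx pE oh mh.
have /(_ _)/cid2-/all_sig2[m mm hm] (n : nat) := ae_preimage_factor (@borel_sigma D)
  (inf_measurable_emeas (@base_ball_open _ _ x n) mh).
exists (sup_integrand (base_ball x) m).
  apply: (sup_integrand_normal _ (@borel_sigma D) mm dx pE) => n.
  exact: base_ball_open.
move/ae_foralln: hm; apply: filterS => w hm z.
rewrite (lsc_sup_inf dx z (oh w)) /sup_integrand.
by congr ereal_sup; apply: eq_imagel => n _; exact: hm.
Qed.

End depends_through.

Lemma rv_depends_measurable_wrt {R : realType} {d : measure_display}
    {Omega : measurableType d} (P : probability Omega R) (E D : topologicalType)
    (C : Omega -> E) (xi : Omega -> D) :
  rv_depends_through P C xi -> measurable_wrt (ae_sigma P xi) C.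
Proof.
move=> [Chat mC CC] B bB; exists (Chat @^-1` B); first exact: mC.
by apply: filterS CC => w /= ->.
Qed.

(** * Matrix-valued maps and Euclidean spaces *)

Section matrices.
Context {R : realType}.

Lemma mx_continuous (T : topologicalType) m n (f : T -> 'M[R]_(m, n)) :
  (forall i j, continuous (fun t => f t i j)) -> continuous f.
Proof.
move=> cf t V [A fA AV]; apply: (@filterS _ (nbhs t) _
  [set s | forall i, [set s | forall j, A i j (f s i j)] s]).
  by move=> s /= fs; apply: AV => i j; exact: fs.
apply: filter_forall => i; apply: filter_forall => j.
by apply: cf; exact: fA.
Qed.

Lemma mulmx_continuous m n p (A : 'M[R]_(m, n)) :
  continuous (fun v : 'M[R]_(n, p) => A *m v)%R.
Proof.
apply: mx_continuous => i j; under eq_fun do rewrite mxE.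
apply: continuous_big => [|k _ v]; first exact: add_continuous.
apply: (@cvgMl_tmp _ _ (nbhs v) _ (fun v : 'M[R]_(n, p) => v k j)).
exact: coord_continuous.
Qed.

Section measurable_mx.
Context {S : pointedType} (G : set_system S) (HG : sigma_algebra setT G).

Lemma measurable_wrt_coord m n (A : S -> 'M[R]_(m, n)) i j :
  measurable_wrt G A ->
  measurable_fun setT ((fun w => A w i j) : g_sigma_algebraType G -> R).
Proof.
move=> mA.
apply: (measurability _ (RGenInftyO.measurableE R)).
move=> _ [_ [r ->] <-]; rewrite setTI; apply: sub_sigma_algebra.
apply: (mA ((fun M : 'M[R]_(m, n) => M i j) @^-1` `]-oo, r[%classic)).
apply: sub_sigma_algebra; apply: open_comp; last exact: interval_open.
by move=> M _; exact: coord_continuous.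
Qed.

Lemma ball_mx_measurable m n (f : S -> 'M[R]_(m, n)) (u : 'M[R]_(m, n)) (e : R) :
  (forall i j, measurable_fun setT ((fun w => f w i j) : g_sigma_algebraType G -> R)) ->
  G [set w | ball u e (f w)].
Proof.
(* Positivity of the radius is part of being in a matrix ball; for a matrix without entries it is
   the only condition. *)
move=> mf; rewrite (_ : mkset _ = [set w | (0 < e)%R /\ forall ij : 'I_m * 'I_n,
  ball (u ij.1 ij.2) e (f w ij.1 ij.2)]); last first.
  apply/seteqP; split=> w [e0 H]; first by split=> // -[i j]; exact: H.
  by split=> // i j; exact: (H (i, j)).
apply: (sigma_and HG); first exact: (sigma_cst HG (0 < e)%R).
apply: (sigma_all HG) => -[i j] /=.
have := mf i j measurableT _ (measurable_ball (u i j) e).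
by rewrite setTI [X in X _ -> _](_ : _ = G)//; exact: sigma_algebra_id.
Qed.

End measurable_mx.

End matrices.

Section euclidean.
Context {R : realType}.

Lemma dense_seq_mx m n : exists x : nat -> 'M[R]_(m, n), dense_seq x.
Proof.
pose x k : 'M[R]_(m, n) :=
  map_mx ratr (odflt 0 (unpickle k : option 'M[rat]_(m, n)))%R.
exists x => z e e0.
have /(_ _)/cid-/all_sig[q qz] (ij : 'I_m * 'I_n) :
    exists q : rat, ball (ratr q : R) e (z ij.1 ij.2).
  have /rat_in_itvoo[q /[!in_itv]/= /andP[zq qe]] :
      (z ij.1 ij.2 - e < z ij.1 ij.2)%R by rewrite ltrBlDr ltrDl.
  exists q; rewrite /ball/= ltr0_norm ?subr_lt0// opprB ltrBlDr -ltrBlDl //.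
exists (pickle (\matrix_(i, j) q (i, j))%R); rewrite /x pickleK.
by split=> // i j; rewrite !mxE; exact: (qz (i, j)).
Qed.

Lemma dense_seq_pair (E1 E2 : normedModType R) :
  (exists x : nat -> E1, dense_seq x) -> (exists y : nat -> E2, dense_seq y) ->
  exists z : nat -> E1 * E2, dense_seq z.
Proof.
move=> [x dx] [y dy].
pose z k := let ij := odflt (0, 0)%N (unpickle k) in (x ij.1, y ij.2).
exists z => -[u v] e e0; have [i iu] := dx u e e0; have [j jv] := dy v e e0.
by exists (pickle (i, j)); rewrite /z pickleK.
Qed.

Lemma proper_cV n : proper_space ('cV[R]_n : normedModType R).
Proof.
move=> c r.
(* A product of segments is compact among row vectors, and transposition carries it to columns. The
   extra 1 in the radius leaves room for the closure. *)
pose K : set 'rV[R]_n := [set v | forall i,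
  (fun a : R => a \in `[(c i ord0 - (r + 1))%R, (c i ord0 + (r + 1))%R]) (v ord0 i)].
have cK : compact K.
  apply: (@rV_compact _ _ (fun i =>
     [set` `[(c i ord0 - (r + 1))%R, (c i ord0 + (r + 1))%R]])) => i.
  exact: segment_compact.
have ctr : continuous (fun v : 'rV[R]_n => v^T : 'cV[R]_n)%R.
  apply: mx_continuous => i j; under eq_fun do rewrite mxE.
  exact: coord_continuous.
apply: (@subclosed_compact _ _ ((fun v : 'rV[R]_n => v^T : 'cV[R]_n)%R @` K)).
- exact: closed_closure.
- by apply: continuous_compact => //; exact: continuous_subspaceT.
move=> v vc; exists v^T%R; last by rewrite trmxK.
have : ball c (r + 1)%R v by apply: closure_ball_double vc; rewrite ltrDl.
move=> [_ cv] i; rewrite /= mxE in_itv/=; have := cv i ord0.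
by rewrite /ball/= ltr_distlC => /andP[/ltW -> /ltW ->].
Qed.

Lemma proper_pair (E1 E2 : normedModType R) : proper_space E1 ->
  proper_space E2 -> proper_space (E1 * E2)%type.
Proof.
move=> p1 p2 [c1 c2] r.
apply: (@subclosed_compact _ _ (closure (ball c1 r) `*` closure (ball c2 r))).
- exact: closed_closure.
- exact: compact_setX.
move=> [u v] uvc; split=> /= V nV.
  have [|[u' v'] [[/= cu' _] [/= Vu' _]]] := uvc (V `*` setT); last by exists u'.
  by exists (V, setT) => //; split => //=; exact: filterT.
have [|[u' v'] [[/= _ cv'] [/= _ Vv']]] := uvc (setT `*` V); last by exists v'.
by exists (setT, V) => //; split => //=; exact: filterT.
Qed.

End euclidean.

(** * Integrals and conditional expectations *)

Section emeas_theory.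
Context {R : realType}.

Lemma emeas_measurable_fun d (S : measurableType d) (f : S -> \bar R) :
  emeas (@measurable d S) f <-> measurable_fun setT f.
Proof.
split=> [mf|mf r]; last first.
  by have := emeasurable_fun_infty_o measurableT mf r%:E; rewrite setTI.
apply: (measurability _ (ErealGenInftyO.measurableE R)).
move=> _ [_ [r ->] <-]; rewrite setTI.
rewrite (_ : _ @^-1` _ = [set w | f w < r%:E]); first exact: mf.
by apply/seteqP; split=> w /=; rewrite in_itv.
Qed.

(** A sigma-algebra generates itself, so [g_sigma_algebraType G] gives access to the calculus of
    measurable functions for any [G]. *)
Lemma emeasP (S : pointedType) (G : set_system S) (f : S -> \bar R) :
  sigma_algebra setT G ->
  emeas G f <-> measurable_fun setT (f : g_sigma_algebraType G -> \bar R).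
Proof.
move=> HG; rewrite -emeas_measurable_fun.
by rewrite [measurable](_ : _ = G)//; exact: sigma_algebra_id.
Qed.

Lemma measurable_wrt_emeas (S : Type) (G : set_system S) (f : S -> \bar R) :
  measurable_wrt G f -> emeas G f.
Proof.
move=> mf r; apply: (mf [set x | x < r%:E]).
by apply: sub_sigma_algebra; exact: open_ereal_lt_ereal.
Qed.

Lemma emeas_sub (S : Type) (G G' : set_system S) (f : S -> \bar R) :
  G `<=` G' -> emeas G f -> emeas G' f.
Proof. by move=> GG' mf r; exact/GG'/mf. Qed.

Lemma emeas_cst (S : Type) (G : set_system S) (c : \bar R) :
  sigma_algebra setT G -> emeas G (cst c).
Proof. by move=> HG r; exact: (sigma_cst HG (c < r%:E)). Qed.

Lemma emeas_nneseries (S : pointedType) (G : set_system S) (f : nat -> S -> \bar R) :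
  sigma_algebra setT G -> (forall n, emeas G (f n)) -> (forall n w, 0 <= f n w) ->
  emeas G (fun w => \sum_(0 <= n <oo) f n w).
Proof.
move=> HG mf f0; apply/(emeasP _ HG).
apply: (@emeasurable_fun_cvg _ _ _ _
   (fun n (w : g_sigma_algebraType G) => \sum_(0 <= i < n) f i w)).
  by move=> n; apply: emeasurable_sum => i; exact/(emeasP _ HG).
by move=> w _; apply: is_cvg_nneseries => n _ _; exact: f0.
Qed.

Lemma emeas_max (S : pointedType) (G : set_system S) (f g : S -> \bar R) :
  sigma_algebra setT G -> emeas G f -> emeas G g ->
  emeas G (fun w => Order.max (f w) (g w)).
Proof.
move=> HG mf mg; apply/(emeasP _ HG).
by apply: measurable_maxe; exact/(emeasP _ HG).
Qed.

Lemma emeas_min (S : pointedType) (G : set_system S) (f g : S -> \bar R) :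
  sigma_algebra setT G -> emeas G f -> emeas G g ->
  emeas G (fun w => Order.min (f w) (g w)).
Proof.
move=> HG mf mg; apply/(emeasP _ HG).
by apply: measurable_mine; exact/(emeasP _ HG).
Qed.

Lemma emeasD (S : pointedType) (G : set_system S) (f g : S -> \bar R) :
  sigma_algebra setT G -> emeas G f -> emeas G g -> emeas G (fun w => f w + g w).
Proof.
move=> HG mf mg; apply/(emeasP _ HG).
by apply: emeasurable_funD; exact/(emeasP _ HG).
Qed.

Lemma emeasN (S : pointedType) (G : set_system S) (f : S -> \bar R) :
  sigma_algebra setT G -> emeas G f -> emeas G (fun w => - f w).
Proof.
move=> HG mf; apply/(emeasP _ HG).
by apply: measurableT_comp => //; exact/(emeasP _ HG).
Qed.

Lemma emeasZ (S : pointedType) (G : set_system S) (c : R) (f : S -> \bar R) :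
  sigma_algebra setT G -> emeas G f -> emeas G (fun w => c%:E * f w).
Proof.
move=> HG mf; apply/(emeasP _ HG).
by apply: measurable_funeM; exact/(emeasP _ HG).
Qed.

End emeas_theory.

Section integral_comparison.
Context {R : realType} {d : measure_display} {Omega : measurableType d}.
Variable P : probability Omega R.
Implicit Types f g : Omega -> \bar R.

(** Integrability is not asked for: positive parts grow, negative parts shrink, and the difference
    of the integrals is monotone even where it is [+oo - +oo]. *)
Lemma le_integral_measurable (D : set Omega) f g : measurable D ->
  measurable_fun D f -> measurable_fun D g -> (forall w, D w -> f w <= g w) ->
  \int[P]_(w in D) f w <= \int[P]_(w in D) g w.
Proof.
move=> mD mf mg fg; rewrite integralE [leRHS]integralE; apply: leeB.
- apply: ge0_le_integral => //; [exact: measurable_funepos..|].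
  move=> w Dw; rewrite !funeposE ge_max le_max (fg _ Dw)/= le_max.
  by rewrite lexx orbT.
- apply: ge0_le_integral => //; [exact: measurable_funeneg..|].
  move=> w Dw; rewrite !funenegE ge_max !le_max leeN2 (fg _ Dw)/=.
  by rewrite lexx orbT.
Qed.

Lemma integralD_nonneg (D : set Omega) f (g : Omega -> R) : measurable D ->
  measurable_fun D f -> \int[P]_(w in D) f^\- w < +oo ->
  measurable_fun D (EFin \o g) -> (forall w, (0 <= g w)%R) ->
  \int[P]_(w in D) (g w)%:E < +oo ->
  \int[P]_(w in D) (f w + (g w)%:E) =
  \int[P]_(w in D) f w + \int[P]_(w in D) (g w)%:E.
Proof.
move=> mD mf fn mg g0 gy; pose h w := f w + (g w)%:E.
have mh : measurable_fun D h by exact: emeasurable_funD.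
have hf w : h^\- w <= f^\- w.
  rewrite !funenegE ge_max !le_max lexx orbT andbT leeN2 leeDl//.
  by rewrite lee_fin.
(* Written without subtraction, the identity for [h = f + g] has nonnegative terms only. It can be
   integrated termwise, and the finite integrals of [h^\-], [f^\-] and [g] are then moved across. *)
have split_eq w : h^\+ w + f^\- w = f^\+ w + (g w)%:E + h^\- w.
  rewrite !funeposE !funenegE /h; have := g0 w; case: (f w) => [u| |] g0w.
  - rewrite -EFinD -!EFinN -!EFin_max -!EFinD; congr EFin.
    move: (g w) g0w => v v0; rewrite !maxEle; do 4 case: ifPn; rewrite -?ltNge; lra.
  - by rewrite ?(addye, maxye, maxNye, oppeK).
  - by rewrite ?(addNye, maxNye, maxye, addey, addye).
have : \int[P]_(w in D) (h^\+ w + f^\- w) =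
       \int[P]_(w in D) (f^\+ w + (g w)%:E + h^\- w).
  by apply: eq_integral => w _; exact: split_eq.
have mhp : measurable_fun D h^\+ by exact: measurable_funepos.
have mhn : measurable_fun D h^\- by exact: measurable_funeneg.
have mfp : measurable_fun D f^\+ by exact: measurable_funepos.
have mfn : measurable_fun D f^\- by exact: measurable_funeneg.
have mfg : measurable_fun D (fun w => f^\+ w + (g w)%:E).
  exact: emeasurable_funD.
rewrite [in LHS]ge0_integralD// [in RHS]ge0_integralD//; last first.
  by move=> w _; rewrite adde_ge0// lee_fin.
rewrite [X in _ = X + _]ge0_integralD//; last by move=> w _; rewrite lee_fin.
have hn : \int[P]_(w in D) h^\- w < +oo.
  apply: le_lt_trans fn.
  exact: (ge0_le_integral P mD (fun w _ => funeneg_ge0 h w) mhn mfn).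
have -> : \int[P]_(w in D) (f w + (g w)%:E) =
    \int[P]_(w in D) h^\+ w - \int[P]_(w in D) h^\- w by exact: integralE.
rewrite (integralE _ _ f).
have : 0 <= \int[P]_(w in D) h^\+ w by apply: integral_ge0.
have : 0 <= \int[P]_(w in D) f^\+ w by apply: integral_ge0.
have : 0 <= \int[P]_(w in D) h^\- w by apply: integral_ge0.
have : 0 <= \int[P]_(w in D) f^\- w by apply: integral_ge0.
have : 0 <= \int[P]_(w in D) (g w)%:E.
  by apply: integral_ge0 => w _; rewrite lee_fin.
move: hn fn gy; move: (\int[P]_(w in D) h^\- w) (\int[P]_(w in D) f^\- w) 
  (\int[P]_(w in D) (g w)%:E) (\int[P]_(w in D) h^\+ w) (\int[P]_(w in D) f^\+ w).
move=> [k| |] [b| |] [e| |] [a| |] [c| |]// _ _ _ _ _ _ _ _.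
by rewrite -!EFinB -!EFinD => -[abc]; congr EFin; lra.
Qed.

Lemma integral_cst_le f (D : set Omega) (c : R) : measurable D ->
  measurable_fun D f -> (forall w, D w -> f w <= c%:E) ->
  \int[P]_(w in D) f w <= c%:E * P D.
Proof.
move=> mD mf fc; rewrite -integral_cst//.
by apply: le_integral_measurable => //; exact: measurable_cst.
Qed.

Lemma integral_cst_ge f (D : set Omega) (c : R) : measurable D ->
  measurable_fun D f -> (forall w, D w -> c%:E <= f w) ->
  c%:E * P D <= \int[P]_(w in D) f w.
Proof.
move=> mD mf fc; rewrite -integral_cst//.
by apply: le_integral_measurable => //; exact: measurable_cst.
Qed.

(** The pattern behind the almost sure inequalities below: on a bad event a function is at least
    [s], yet its integral there is at most that of the smaller constant [r]. *)
Lemma null_of_lt_cst (D : set Omega) (r s : R) : measurable D -> (r < s)%R ->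
  s%:E * P D <= r%:E * P D -> P D = 0.
Proof.
move=> mD rs; have : 0 <= P D by [].
rewrite -(@fineK _ (P D)) ?fin_num_measure//; move: (fine (P D)) => p p0.
rewrite -!EFinM lee_fin => srp.
rewrite lee_fin in p0.
congr EFin; apply/eqP; rewrite eq_le p0 andbT.
by rewrite -(pmulr_rle0 (x := s - r)%R) ?subr_gt0// mulrBl subr_le0.
Qed.

Variables (G : set_system Omega).
Hypotheses (HG : sigma_algebra setT G) (Gm : G `<=` measurable).

Lemma emeas_measurable (D : set Omega) f : emeas G f -> measurable D ->
  measurable_fun D f.
Proof.
move=> mf mD; apply: (measurable_funS measurableT) => //.
exact/emeas_measurable_fun/(emeas_sub Gm).
Qed.

Lemma ae_le_cst f (c : R) : emeas G f ->
  (forall A, G A -> \int[P]_(w in A) f w <= c%:E * P A) ->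
  \forall w \ae P, f w <= c%:E.
Proof.
move=> mf fc.
have : \forall w \ae P, forall k, ~ ((c + k.+1%:R^-1)%:E < f w).
  apply/ae_foralln => k; set s := (c + _)%R.
  have GD : G [set w | s%:E < f w].
    by apply: (emeas_lte2 HG) => //; exact: (emeas_cst s%:E HG).
  have PD : P [set w | s%:E < f w] = 0.
    apply: (@null_of_lt_cst _ c s); [exact: Gm|by rewrite ltrDl invr_gt0|].
    apply: le_trans (fc _ GD); apply: integral_cst_ge => [||w /ltW//].
      exact: Gm.
    by apply: emeas_measurable => //; exact: Gm.
  exists [set w | s%:E < f w]; split=> [| |w /= /contrapT//]; [exact: Gm|exact: PD].
apply: filterS => w fw; rewrite leNgt; apply/negP => /ereal_lt_rat[q /andP[cq qf]].
have [|k kq] := @small_inv _ (ratr q - c)%R; first by rewrite subr_gt0 -lte_fin.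
by apply: (fw k); apply: lt_trans qf; rewrite lte_fin -ltrBrDl.
Qed.

Lemma ae_ge_cst f (c : R) : emeas G f ->
  (forall A, G A -> c%:E * P A <= \int[P]_(w in A) f w) ->
  \forall w \ae P, c%:E <= f w.
Proof.
move=> mf fc.
have : \forall w \ae P, forall k, ~ (f w < (c - k.+1%:R^-1)%:E).
  apply/ae_foralln => k; set s := (c - _)%R.
  have GD : G [set w | f w < s%:E] by exact: mf.
  have PD : P [set w | f w < s%:E] = 0.
    apply: (@null_of_lt_cst _ s c); [exact: Gm|by rewrite ltrBlDr ltrDl invr_gt0|].
    apply: le_trans (fc _ GD) _; apply: integral_cst_le => [||w /ltW//].
      exact: Gm.
    by apply: emeas_measurable => //; exact: Gm.
  exists [set w | f w < s%:E]; split=> [| |w /= /contrapT//]; [exact: Gm|exact: PD].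
apply: filterS => w fw; rewrite leNgt; apply/negP => /ereal_lt_rat[q /andP[fq qc]].
have [|k kq] := @small_inv _ (c - ratr q)%R; first by rewrite subr_gt0 -lte_fin.
by apply: (fw k); apply: lt_trans fq _; rewrite lte_fin ltrBrDl -ltrBrDr.
Qed.

End integral_comparison.

(** * Conditional expectations measurable for a smaller sigma-algebra *)

Section cond_version.
Context {R : realType} {d : measure_display} {Omega : measurableType d}.
Variable P : probability Omega R.
Variables G F : set_system Omega.
Hypotheses (HG : sigma_algebra setT G) (GF : G `<=` F) (Fm : F `<=` measurable).

Let Gm : G `<=` measurable. Proof. exact: subset_trans Fm. Qed.

(** [Z] is tested on all of [F] although it is measurable for [G]: it is a conditional expectation
    given [F] that uses only the information in [G]. With [G] equal to [F] it is the ordinary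
    one. *)
Definition cond_version (f Z : Omega -> \bar R) :=
  [/\ emeas G Z, forall w, 0 <= Z w &
      forall A, F A -> \int[P]_(w in A) Z w = \int[P]_(w in A) f w].

(* [S] has a conditional probability given [F] that is [G]-measurable. *)
Definition cond_probable (S : set Omega) := measurable S /\
  exists2 Z : Omega -> \bar R, emeas G Z &
    forall A, F A -> \int[P]_(w in A) Z w = P (S `&` A).

(** Values are in [0, 1] almost surely; clamping makes this hold everywhere, so that [1 - Z] and
    series of versions are nonnegative without exceptional sets. *)
Lemma cond_probable_clamp S : cond_probable S -> exists Z : Omega -> \bar R,
  [/\ emeas G Z, forall w, 0 <= Z w, forall w, Z w <= 1 &
      forall A, F A -> \int[P]_(w in A) Z w = P (S `&` A)].
Proof.
move=> [mS [Z mZ ZS]].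
pose Z' w := Order.min (Order.max (Z w) 0) 1.
have mZ' : emeas G Z'.
  apply: emeas_min => //; last exact: (emeas_cst 1%E HG).
  by apply: emeas_max => //; exact: (emeas_cst 0%E HG).
exists Z'; split=> //.
- by move=> w; rewrite /Z' le_min lee01 andbT le_max lexx orbT.
- by move=> w; rewrite /Z' ge_min lexx orbT.
move=> A FA; rewrite -(ZS A FA); apply: ae_eq_integral.
- exact: Fm.
- by apply: (emeas_measurable Gm) => //; exact: Fm.
- by apply: (emeas_measurable Gm) => //; exact: Fm.
have Z_ge0 : \forall w \ae P, 0%:E <= Z w.
  apply: (ae_ge_cst Gm mZ) => B GB; rewrite mul0e ZS//; exact: GF.
have Z_le1 : \forall w \ae P, Z w <= 1%:E.
  apply: (ae_le_cst HG Gm mZ) => B GB; rewrite mul1e ZS; last exact: GF.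
  by apply: le_measure; rewrite ?inE;
    [apply: measurableI => //; exact: Gm|exact: Gm|exact: subIsetr].
apply: filterS2 Z_ge0 Z_le1 => w Z0 Z1 _; rewrite /Z'.
by rewrite (max_idPl Z0) (min_idPl Z1).
Qed.

(** Versions complement to 1 and add over disjoint unions, but they do not determine a version for
    an intersection. Hence a Dynkin class rather than a sigma-algebra. *)
Lemma cond_probable_dynkin : dynkin cond_probable.
Proof.
split.
- split; first exact: measurableT.
  exists (cst 1); first exact: emeas_cst.
  by move=> A FA; rewrite integral_cst ?mul1e ?setTI//; exact: Fm.
- move=> S cS; have [mS _] := cS; split; first exact: measurableC.
  have [Z [mZ Z0 Z1 ZS]] := cond_probable_clamp cS.
  have mZ' : emeas G (fun w => 1 - Z w).
    by apply: emeasD => //; [exact: emeas_cst|exact: emeasN].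
  exists (fun w => 1 - Z w) => // A FA; have mA := Fm FA.
  have Zf w : Z w \is a fin_num.
    by rewrite ge0_fin_numE//; apply: le_lt_trans (Z1 w) _; exact: ltry.
  have : \int[P]_(w in A) (1 - Z w + Z w) = \int[P]_(w in A) (cst 1) w.
    by apply: eq_integral => w _; rewrite subeK.
  rewrite integral_cst// mul1e ge0_integralD//; last 3 first.
  + by move=> w _; rewrite sube_ge0 ?Zf.
  + exact: (emeas_measurable Gm).
  + exact: (emeas_measurable Gm).
  rewrite ZS// => int1Z; rewrite -[LHS](addeK (x := P (S `&` A))).
    rewrite int1Z (_ : ~` S `&` A = A `\` S); last by rewrite setDE setIC.
    rewrite measureD//; first by rewrite setIC.
    by rewrite ltey_eq fin_num_measure.
  by rewrite fin_num_measure//; exact: measurableI.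
move=> S tS cS; split; first by apply: bigcup_measurable => n _; have [] := cS n.
have /(_ _)/cid-/all_sig[Z HZ] (n : nat) := cond_probable_clamp (cS n).
exists (fun w => \sum_(0 <= n <oo) Z n w).
  by apply: emeas_nneseries => // n; have [] := HZ n.
move=> A FA; have mA := Fm FA.
rewrite integral_nneseries//; last 2 first.
- by move=> n; have [mZ _ _ _] := HZ n; exact: (emeas_measurable Gm).
- by move=> n w _; have [] := HZ n.
rewrite setI_bigcupl measure_semi_bigcup//; last 3 first.
- by move=> n; apply: measurableI => //; have [] := cS n.
- exact: trivIset_setIr.
- by apply: bigcup_measurable => n _; apply: measurableI => //; have [] := cS n.
by apply: eq_eseriesr => n _; have [_ _ _ ->] := HZ n.
Qed.

Lemma cond_version_cst0 : exists Z, cond_version (cst 0) Z.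
Proof. by exists (cst 0); split=> //; exact: emeas_cst. Qed.

Lemma cond_versionD f1 f2 Z1 Z2 :
  measurable_fun setT f1 -> measurable_fun setT f2 ->
  (forall w, 0 <= f1 w) -> (forall w, 0 <= f2 w) ->
  cond_version f1 Z1 -> cond_version f2 Z2 ->
  cond_version (fun w => f1 w + f2 w) (fun w => Z1 w + Z2 w).
Proof.
move=> mf1 mf2 f10 f20 [mZ1 Z10 Z1f] [mZ2 Z20 Z2f]; split.
- exact: emeasD.
- by move=> w; rewrite adde_ge0.
move=> A FA; have mA := Fm FA.
by rewrite !ge0_integralD ?Z1f ?Z2f//;
  first [exact: (measurable_funS measurableT)|exact: (emeas_measurable Gm)].
Qed.

Lemma cond_version_indic S (r : R) : (0 <= r)%R -> cond_probable S ->
  exists Z, cond_version (fun w => (r * \1_S w)%:E) Z.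
Proof.
move=> r0 cS; have [mS _] := cS; have [Z [mZ Z0 Z1 ZS]] := cond_probable_clamp cS.
exists (fun w => r%:E * Z w); split.
- exact: emeasZ.
- by move=> w; rewrite mule_ge0.
move=> A FA; have mA := Fm FA.
rewrite ge0_integralZl//; last exact: (emeas_measurable Gm).
under [RHS]eq_integral do rewrite EFinM.
rewrite ge0_integralZl//; first by rewrite ZS// integral_indic.
by apply/measurable_EFinP; exact: measurable_indic.
Qed.

Lemma cond_version_sum (I : Type) (s : seq I) (f : I -> Omega -> \bar R) :
  (forall i, measurable_fun setT (f i)) -> (forall i w, 0 <= f i w) ->
  (forall i, exists Z, cond_version (f i) Z) ->
  exists Z, cond_version (fun w => \sum_(i <- s) f i w) Z.
Proof.
move=> mf f0 cf; elim: s => [|i s [Z cZ]].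
  have [Z cZ] := cond_version_cst0; exists Z; congr cond_version: cZ.
  by apply/funext => w; rewrite big_nil.
have [Z' cZ'] := cf i; exists (fun w => Z' w + Z w).
rewrite (_ : (fun w => _) = fun w => f i w + \sum_(j <- s) f j w); last first.
  by apply/funext => w; rewrite big_cons.
apply: cond_versionD => //; first exact: emeasurable_sum.
by move=> w; apply: sume_ge0.
Qed.

Lemma cond_version_nneseries (f : nat -> Omega -> \bar R) :
  (forall n, measurable_fun setT (f n)) -> (forall n w, 0 <= f n w) ->
  (forall n, exists Z, cond_version (f n) Z) ->
  exists Z, cond_version (fun w => \sum_(0 <= n <oo) f n w) Z.
Proof.
move=> mf f0 /(_ _)/cid-/all_sig[Z HZ]; exists (fun w => \sum_(0 <= n <oo) Z n w).
split.
- by apply: emeas_nneseries => // n; have [] := HZ n.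
- by move=> w; apply: nneseries_ge0 => n _ _; have [] := HZ n.
move=> A FA; have mA := Fm FA; rewrite !integral_nneseries//.
- by apply: eq_eseriesr => n _; have [_ _ ->] := HZ n.
- by move=> n; exact: (measurable_funS measurableT).
- by move=> n; have [mZ _ _] := HZ n; exact: (emeas_measurable Gm).
- by move=> n w _; have [] := HZ n.
Qed.

End cond_version.

Section cond_version_borel.
Import HBSimple HBNNSimple.
Context {R : realType} {d : measure_display} {Omega : measurableType d}.
Variable P : probability Omega R.
Variables G F : set_system Omega.
Hypotheses (HG : sigma_algebra setT G) (GF : G `<=` F) (Fm : F `<=` measurable).
Variables (D : normedModType R) (xi : Omega -> D).
Hypothesis mxi : measurable_wrt measurable xi.
Hypothesis cxi : forall B, borel D B -> cond_probable P G F (xi @^-1` B).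

Let DT := g_sigma_algebraType (@open D).

Let xi_measurable (g : DT -> \bar R) : measurable_fun setT g ->
  measurable_fun setT (fun w => g (xi w)).
Proof.
move=> mg _ B mB; rewrite setTI; have := mg measurableT B mB.
by rewrite setTI => mgB; exact: (mxi mgB).
Qed.

Let cond_version_sfun (g : {sfun DT >-> R}) : (forall s, (0 <= g s)%R) ->
  exists Z, cond_version P G F (fun w => (g (xi w))%:E) Z.
Proof.
move=> g0.
(* [cond_version_sum] wants nonnegative terms at every real index; negative [r], which [g] never
   takes, contribute 0. *)
pose f (r : R) w := (if (0 <= r)%R then (r * \1_(g @^-1` [set r]) (xi w))%:E else 0).
rewrite (_ : (fun w => _) = fun w => \sum_(r <- finmap.enum_fset (fset_set (range g))) f r w); last first.
  apply/funext => w; rewrite fimfunE fsbig_finite//= -sumEFin.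
  rewrite [LHS]big_seq_cond [RHS]big_seq_cond.
  apply: eq_bigr => r /andP[+ _]; rewrite in_fset_set// => /set_mem[s _ <-].
  by rewrite /f g0.
have mB r : borel D (g @^-1` [set r]).
  by rewrite -[X in borel _ X]setTI; apply: (@measurable_funPT _ _ _ _ g).
apply: cond_version_sum => //.
- move=> r; have [r0|r0] := boolP (0 <= r)%R; last first.
    by rewrite /f (negbTE r0); exact: measurable_cst.
  rewrite /f r0.
  apply/measurable_EFinP; apply: measurable_funM => //.
  apply: (@measurable_indic _ _ _ _ (xi @^-1` (g @^-1` [set r]))).
  exact: (mxi (mB r)).
- by move=> r w; rewrite /f; case: ifP => // r0; rewrite lee_fin mulr_ge0.
move=> r; have [r0|r0] := boolP (0 <= r)%R; last first.
  by rewrite /f (negbTE r0); exact: cond_version_cst0.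
by rewrite /f r0; exact: (cond_version_indic HG GF Fm r0 (cxi (mB r))).
Qed.

Lemma cond_version_comp (g : D -> \bar R) : emeas (borel D) g ->
  (forall s, 0 <= g s) -> exists Z, cond_version P G F (fun w => g (xi w)) Z.
Proof.
move=> mg g0.
have mg' : measurable_fun [set: DT] g by exact/emeas_measurable_fun.
(* A leading 0 is put before the simple approximations, so that the partial sums of the increments
   [b] are exactly the approximations. Additivity over nonnegative series then replaces a passage to
   the limit. *)
pose a n : {sfun DT >-> R} :=
  if n is n'.+1 then nnsfun_approx measurableT mg' n' else 0%R.
have a_nd n s : (a n s <= a n.+1 s)%R.
  case: n => [|n] /=; first exact: fun_ge0.
  by have /lefP := nd_nnsfun_approx measurableT mg' (leqnSn n); exact.
pose b n : {sfun DT >-> R} := (a n.+1 - a n)%R.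
have b0 n s : (0 <= b n s)%R by rewrite /b /= subr_ge0.
rewrite (_ : (fun w => _) = fun w => \sum_(0 <= n <oo) (b n (xi w))%:E); last first.
  apply/funext => w; apply/esym/cvg_lim => //.
  under eq_cvg => n do rewrite sumEFin /b /= telescope_sumr// subr0.
  have : [sequence (a n.+1 (xi w))%:E]_n @ \oo --> g (xi w).
    exact: (cvg_nnsfun_approx measurableT mg' (fun s _ => g0 s)).
  by rewrite (cvg_shiftS (fun n => (a n (xi w))%:E)).
apply: cond_version_nneseries => //.
- move=> n; apply: (@xi_measurable (fun s => (b n s)%:E)).
  by apply/measurable_EFinP.
- by move=> n w; rewrite lee_fin.
by move=> n; exact: cond_version_sfun.
Qed.

End cond_version_borel.

(** * The Markov property jointly with independent noise *)

Section rectangles.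
Context {R : realType} {D1 D2 D3 : normedModType R}.
Hypotheses (sep1 : exists x : nat -> D1, dense_seq x)
  (sep2 : exists x : nat -> D2, dense_seq x) (sep3 : exists x : nat -> D3, dense_seq x).

Definition rectangles : set_system (D1 * D2 * D3) :=
  [set B | exists B1 B2 B3, [/\ borel D1 B1, borel D2 B2, borel D3 B3 &
                              B = B1 `*` B2 `*` B3]].

Lemma rectangles_setI : setI_closed rectangles.
Proof.
move=> _ _ [B1 [B2 [B3 [b1 b2 b3 ->]]]] [C1 [C2 [C3 [c1 c2 c3 ->]]]].
exists (B1 `&` C1), (B2 `&` C2), (B3 `&` C3); split.
- exact: (sigma_and (borel_sigma _)).
- exact: (sigma_and (borel_sigma _)).
- exact: (sigma_and (borel_sigma _)).
by apply/seteqP; split=> -[[a b] c] /=; [move=> [[[? ?] ?] [[? ?] ?]]|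
  move=> [[[? ?] [? ?]] [? ?]]].
Qed.

(** Separability enters here: an open set is a countable union of products of base balls. *)
Lemma borel_rectangles : borel (D1 * D2 * D3)%type `<=` <<s rectangles >>.
Proof.
have [x dx] := sep1; have [y dy] := sep2; have [z dz] := sep3.
have Hs := @smallest_sigma_algebra _ setT rectangles.
apply: smallest_sub => // U oU.
rewrite (_ : U = [set s | exists ijk : nat * nat * nat,
  (base_ball x ijk.1.1 `*` base_ball y ijk.1.2 `*` base_ball z ijk.2 `<=` U) /\
  (base_ball x ijk.1.1 `*` base_ball y ijk.1.2 `*` base_ball z ijk.2) s]).
  apply: (sigma_ex Hs) => -[[i j] k]; apply: (sigma_and Hs).
    exact: (sigma_cst Hs (_ `<=` _)).
  apply: sub_sigma_algebra; exists (base_ball x i), (base_ball y j), (base_ball z k).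
  by split=> //; apply: sub_sigma_algebra; exact: base_ball_open.
apply/seteqP; split=> [[[a b] c] Us|s [ijk [sU /sU]]//].
have [[V V3] /= [[[V1 V2] /= [nV1 nV2] V12] nV3] VU] := open_nbhs_nbhs (conj oU Us).
have [i ai iV] := base_ballP dx nV1.
have [j bj jV] := base_ballP dy nV2.
have [k ck kV] := base_ballP dz nV3.
exists (i, j, k); split=> // -[[a' b'] c'] [[/= /iV ? /jV ?] /kV ?].
by apply: VU; split=> //=; exact: V12.
Qed.

End rectangles.

Section markov_step.
Context {R : realType} {d : measure_display} {Omega : measurableType d}.
Variable P : probability Omega R.
Context {D1 D2 D3 : normedModType R}.
Hypotheses (sep1 : exists x : nat -> D1, dense_seq x)
  (sep2 : exists x : nat -> D2, dense_seq x) (sep3 : exists x : nat -> D3, dense_seq x).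
Variables (F : set_system Omega) (u : Omega -> D1) (v : Omega -> D2) (y : Omega -> D3).
Hypotheses (HF : sigma_algebra setT F) (Fm : F `<=` measurable).
Hypotheses (mu : measurable_wrt F u) (mv : measurable_wrt measurable v)
  (my : measurable_wrt measurable y).
Hypothesis markov_v : forall B, borel D2 B -> exists Z : Omega -> \bar R,
  is_cond_expectation P (sigma_of u) (EFin \o \1_(v @^-1` B)) Z /\
  is_cond_expectation P F (EFin \o \1_(v @^-1` B)) Z.
Hypothesis indep_y : independent P (sigma_of y) <<s F `|` sigma_of v >>.

Lemma sigma_of_sigma : sigma_algebra setT (sigma_of u).
Proof. exact/sigma_algebra_preimage/borel_sigma. Qed.

Lemma sigma_of_preimage B : borel D1 B -> sigma_of u (u @^-1` B).
Proof. by move=> bB; exists B => //; rewrite setTI. Qed.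

Lemma sigma_of_sub : sigma_of u `<=` F.
Proof. by move=> _ [B bB <-]; rewrite setTI; exact: mu. Qed.

(** The version is P(y in B3) 1_B1(u) Z, with Z = P(v in B2 | u). The indicator restricts the test
    event, the Markov property handles [v], and independence of [y] from [F] and [v] together
    supplies the constant factor. *)
Lemma cond_probable_rectangle B1 B2 B3 :
  borel D1 B1 -> borel D2 B2 -> borel D3 B3 ->
  cond_probable P (sigma_of u) F
    ((u @^-1` B1) `&` (v @^-1` B2) `&` (y @^-1` B3)).
Proof.
move=> b1 b2 b3; have Hu := sigma_of_sigma.
have mU : measurable (u @^-1` B1) by exact/Fm/mu.
have mV : measurable (v @^-1` B2) := mv b2.
have mY : measurable (y @^-1` B3) := my b3.
split; first by apply: measurableI => //; exact: measurableI.
have [Z0 [[mZ0 _] [_ Z0F]]] := markov_v b2.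
have [|Z [mZ Z_ge0 _ ZF]] := @cond_probable_clamp _ _ _ P (sigma_of u) F Hu
    sigma_of_sub Fm (v @^-1` B2).
  split=> //; exists Z0; first exact: measurable_wrt_emeas.
  by move=> A FA; rewrite Z0F// integral_indic//; exact: Fm.
have mZU : emeas (sigma_of u) (Z \_ (u @^-1` B1)).
  move=> r; rewrite (_ : mkset _ = [set w | (B1 (u w) /\ Z w < r%:E) \/
      (~ B1 (u w) /\ 0 < r%:E)]); last first.
    apply/seteqP; split=> w /=; rewrite patchE.
      case: ifPn => [/set_mem|/negP/contra_not]; first by left.
      by move=> nB rw; right; split => // /mem_set; apply: nB => //; exact.
    move=> [[Bw Zr]|[nB r0]]; first by rewrite mem_set.
    by rewrite memNset.
  have sB : sigma_of u [set w | B1 (u w)] by exact: sigma_of_preimage.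
  apply: (sigma_or Hu); apply: (sigma_and Hu) => //; first exact: (sigma_not Hu).
  exact: (sigma_cst Hu (0 < r%:E)).
exists (fun w => (fine (P (y @^-1` B3)))%:E * (Z \_ (u @^-1` B1)) w).
  exact: emeasZ.
move=> A FA; have mA := Fm FA.
rewrite ge0_integralZl//; last 3 first.
- exact: (emeas_measurable (subset_trans sigma_of_sub Fm)).
- by move=> w _; rewrite patchE; case: ifP.
- by rewrite lee_fin fine_ge0.
rewrite fineK ?fin_num_measure// -integral_mkcondr ZF; last first.
  by apply: (sigma_and HF) => //; exact: mu.
rewrite -indep_y.
- by congr (P _); apply/seteqP; split=> w /=; tauto.
- by exists B3 => //; rewrite setTI.
have Hs := @smallest_sigma_algebra _ setT (F `|` sigma_of v).
apply: (sigma_and Hs).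
  by apply: sub_sigma_algebra; right; exists B2 => //; rewrite setTI.
apply: sub_sigma_algebra; left; apply: (sigma_and HF) => //; exact: mu.
Qed.

Lemma cond_probable_markov B : borel (D1 * D2 * D3)%type B ->
  cond_probable P (sigma_of u) F ((fun w => (u w, v w, y w)) @^-1` B).
Proof.
move=> /(borel_rectangles sep1 sep2 sep3).
rewrite -setI_closed_g_dynkin_g_sigma_algebra; last exact: rectangles_setI.
pose xi w := (u w, v w, y w).
have [cT cC cU] := cond_probable_dynkin P sigma_of_sigma sigma_of_sub Fm.
apply: (smallest_sub (X := [set B | cond_probable P (sigma_of u) F (xi @^-1` B)])).
  split=> /=.
  - by rewrite preimage_setT.
  - by move=> A cA /=; rewrite preimage_setC; exact: cC.
  - move=> A tA cA /=; rewrite preimage_bigcup; apply: cU => //.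
    by move=> i j _ _ [w [Ai Aj]]; apply: (tA i j) => //; exists (xi w).
move=> _ [B1 [B2 [B3 [b1 b2 b3 ->]]]] /=.
exact: cond_probable_rectangle.
Qed.

End markov_step.

Section cond_version_ae.
Context {R : realType} {d : measure_display} {Omega : measurableType d}.
Variable P : probability Omega R.
Variables G F : set_system Omega.
Hypotheses (HG : sigma_algebra setT G) (GF : G `<=` F) (Fm : F `<=` measurable).
Variables (D : normedModType R) (xi : Omega -> D).
Hypothesis mxi : measurable_wrt measurable xi.
Hypothesis cxi : forall B, borel D B -> cond_probable P G F (xi @^-1` B).

(** [f] equals a Borel function [g] of [xi] only almost surely, and elsewhere [g] may be negative,
    hence the truncation. Measurability of [f] is a separate hypothesis because [ae_sigma] may
    contain sets that are not measurable. *)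
Lemma cond_version_ae (f : Omega -> \bar R) : emeas measurable f ->
  (forall w, 0 <= f w) -> emeas (ae_sigma P xi) f ->
  exists Z, cond_version P G F f Z.
Proof.
move=> mf f0 /(ae_preimage_factor (@borel_sigma D))[g mg fg].
have mg0 : emeas (borel D) (fun s => Order.max (g s) 0).
  exact: (emeas_max (@borel_sigma D) mg (emeas_cst 0 (@borel_sigma D))).
have [|Z [mZ Z0 Zg]] := cond_version_comp HG GF Fm mxi cxi mg0.
  by move=> s; rewrite le_max lexx orbT.
exists Z; split=> // A FA; rewrite Zg//.
have mA := Fm FA; apply: ae_eq_integral => //.
- apply: (emeas_measurable (@subset_refl _ measurable)) => // r.
  exact: (mxi (mg0 r)).
- exact: (emeas_measurable (@subset_refl _ measurable)).
by apply: filterS fg => w fg _ /=; rewrite -fg; exact/max_idPl.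
Qed.

End cond_version_ae.

(** * Conditional expectation of a normal integrand *)

Lemma ae_forall_countable {R : realType} {d : measure_display}
    {Omega : measurableType d} (P : probability Omega R) (I : countType)
    (A : I -> Omega -> Prop) :
  (forall i, \forall w \ae P, A i w) -> \forall w \ae P, forall i, A i w.
Proof.
move=> PA.
have : \forall w \ae P, forall k, if unpickle k is Some i then A i w else True.
  by apply/ae_foralln => k; case: unpickle => [i|]; [exact: PA|exact: aeW].
by apply: filterS => w Aw i; have := Aw (pickle i); rewrite pickleK.
Qed.

Lemma limn_einf_sup_einfs {R : realType} (u : (\bar R)^nat) :
  limn_einf u = ereal_sup (range (einfs u)).
Proof.
rewrite limn_einf_lim; apply/cvg_lim => //.
exact/ereal_nondecreasing_cvgn/nondecreasing_einfs.
Qed.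

Lemma limn_einf_le {R : realType} (u : (\bar R)^nat) (c : \bar R) :
  (forall n, u n <= c) -> limn_einf u <= c.
Proof.
move=> uc; rewrite limn_einf_sup_einfs; apply: ge_ereal_sup => _ [n _ <-].
apply: le_trans (uc n); apply: ereal_inf_lbound.
by exists n => //=.
Qed.

Lemma limn_einf_ge {R : realType} (u : (\bar R)^nat) (c : \bar R) :
  (forall a : R, a%:E < c -> exists n, forall m, (n <= m)%N -> a%:E <= u m) ->
  c <= limn_einf u.
Proof.
move=> uc; rewrite leNgt; apply/negP => /ereal_lt_rat[q /andP[uq qc]].
have [n nu] := uc _ qc; move: uq; apply/negP; rewrite -leNgt limn_einf_sup_einfs.
apply: (@le_trans _ _ (einfs u n)).
  by apply: le_ereal_inf_tmp => _ [m /= nm <-]; exact: nu.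
by apply: ereal_sup_ubound; exists n.
Qed.

Section cond_integrand_sup.
Context {R : realType} {d : measure_display} {Omega : measurableType d}.
Variable P : probability Omega R.
Context {E : normedModType R}.
Variables (F : set_system Omega) (x : nat -> E).
Hypotheses (HF : sigma_algebra setT F) (Fm : F `<=` measurable).
Hypotheses (dx : dense_seq x) (pE : proper_space E).
Variables (h k : E -> Omega -> \bar R) (e : nat -> Omega -> \bar R).
Hypotheses (oh : forall w (a : R), open [set z | a%:E < h z w])
  (mh : inf_measurable measurable h) (h0 : forall z w, 0 <= h z w).
Hypotheses (ok : forall w (a : R), open [set z | a%:E < k z w])
  (mk : inf_measurable F k).
Hypothesis kh : forall X, measurable_wrt F X -> forall A, F A ->
  \int[P]_(w in A) k (X w) w = \int[P]_(w in A) h (X w) w.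

Let B := base_ball x.
Let q n w := ereal_inf [set h z w | z in B n].

Hypothesis qe : forall n, cond_version P F F (q n) (e n).

Let Hm : sigma_algebra setT (@measurable d Omega).
Proof. exact: sigma_algebra_measurable. Qed.

Let me n : emeas F (e n). Proof. by have [] := qe n. Qed.

Let mq n : emeas measurable (q n).
Proof. exact: (inf_measurable_emeas (@base_ball_open _ _ _ _)). Qed.

Let q0 n w : 0 <= q n w.
Proof. by apply: le_ereal_inf_tmp => _ [z _ <-]. Qed.

Lemma closure_lt_le (g : E -> \bar R) (V : set E) (r : R) p :
  (forall a : R, open [set z | a%:E < g z]) ->
  closure [set z | V z /\ g z < r%:E] p -> closure V p /\ g p <= r%:E.
Proof.
move=> og cp; split.
  by apply: closureS cp => z [].
rewrite leNgt; apply/negP => rp.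
have [z [[_ gr] rg]] := cp _ (open_nbhs_nbhs (conj (og r) rp)).
by have := lt_trans gr rg; rewrite ltxx.
Qed.

(** A selection lies only in a closure, so strict constraints become weak ones. The comparisons
    below therefore use two balls, one with its closure inside the other, and two levels r < s. *)
Lemma ball_selection (g : E -> Omega -> \bar R) n (r : R) :
  (forall w (a : R), open [set z | a%:E < g z w]) -> inf_measurable F g ->
  exists2 X, measurable_wrt F X & forall w, (exists2 z, B n z & g z w < r%:E) ->
    closure (B n) (X w) /\ g (X w) w <= r%:E.
Proof.
move=> og mg.
have [|X mX XC] := @measurable_selection _ _ _ F x
   (fun w => [set z | B n z /\ g z w < r%:E]) HF dx pE.
  move=> U oU; rewrite (_ : mkset _ = [set w | exists2 z, (U `&` B n) z & g z w < r%:E]).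
    by apply: mg; apply: openI => //; exact: base_ball_open.
  by apply/seteqP; split=> w [z]; [move=> Uz [Bz gz]|move=> [Uz Bz] gz]; exists z.
exists X => // w [z Bz gz]; apply: (closure_lt_le (og w)).
by apply: XC; exists z.
Qed.

Let comp_measurable X A : measurable_wrt F X -> F A ->
  measurable_fun A (fun w => h (X w) w) /\ measurable_fun A (fun w => k (X w) w).
Proof.
move=> mX FA; split.
  apply: (emeas_measurable (@subset_refl _ measurable)); last exact: Fm.
  apply: (inf_measurable_comp Hm dx oh mh) => C bC; exact/Fm/mX.
apply: (emeas_measurable Fm); last exact: Fm.
exact: (inf_measurable_comp HF dx ok mk).
Qed.

(** On a bad event select [X] in [B n] with [k] at most [r], while [e n] exceeds [s]. Then s P(D) <=
    int e_n = int q_n <= int h(X) = int k(X) <= r P(D), so the event is null; there are countably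
    many of them. *)
Lemma sup_integrand_le_cond :
  \forall w \ae P, forall z, sup_integrand B e z w <= k z w.
Proof.
have : \forall w \ae P, forall mnrs : (nat * nat) * (rat * rat),
    closure (B mnrs.1.1) `<=` B mnrs.1.2 -> (ratr mnrs.2.1 < ratr mnrs.2.2 :> R)%R ->
    ~ ((exists2 z, B mnrs.1.1 z & k z w < (ratr mnrs.2.1)%:E) /\
       (ratr mnrs.2.2)%:E < e mnrs.1.2 w).
  apply: ae_forall_countable => -[[m n] [r s]] /=.
  have [mn|nmn] := pselect (closure (B m) `<=` B n); last exact: aeW.
  have [rs|nrs] := pselect (ratr r < ratr s :> R)%R; last exact: aeW.
  pose D := [set w | (exists2 z, B m z & k z w < (ratr r)%:E) /\ (ratr s)%:E < e n w].
  have FD : F D.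
    apply: (sigma_and HF); first exact/mk/base_ball_open.
    exact: (emeas_lte2 HF (emeas_cst (ratr s)%:E HF)).
  have mD := Fm FD.
  have [X mX XB] := ball_selection m (ratr r) ok mk.
  have [mhX mkX] := comp_measurable mX FD.
  have PD : P D = 0.
    apply: (@null_of_lt_cst _ _ _ P D (ratr r) (ratr s)) => //.
    apply: (@le_trans _ _ (\int[P]_(w in D) e n w)).
      apply: integral_cst_ge => // [|w [_ /ltW]//].
      exact: (emeas_measurable Fm).
    apply: (@le_trans _ _ (\int[P]_(w in D) k (X w) w)); last first.
      by apply: integral_cst_le => // w [/XB[_ ?] _].
    rewrite kh//; have [_ _ ->//] := qe n.
    apply: le_integral_measurable => //.
      exact: (emeas_measurable (@subset_refl _ measurable)).
    move=> w [/XB[/mn nX _] _]; apply: ereal_inf_lbound; exists (X w) => //.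
  by exists D; split=> // w /= nw; apply: contrapT => nDw; apply: nw => _ _.
apply: filterS => w kw z; apply/sup_integrand_le => n nz; rewrite leNgt.
apply/negP => /ereal_lt_rat[s /andP[ks se]].
have [r /andP[kr rs]] := ereal_lt_rat ks.
have [m mz mn] := base_ball_nbhs dx (open_nbhs_nbhs (conj (@base_ball_open _ _ x n) nz)).
by apply: (kw ((m, n), (r, s))) => //; split=> //; exists z.
Qed.

(** [N j w] is the first ball of radius 1/(j+1) that contains [X w]. By lower semicontinuity [q] at
    this index tends to [h (X w) w], while its integral is that of [e], at most r P(D); Fatou's
    lemma passes to the limit. *)
Lemma integral_le_sup_integrand X D (r : R) : measurable_wrt F X -> F D ->
  (forall w, D w -> sup_integrand B e (X w) w <= r%:E) ->
  \int[P]_(w in D) h (X w) w <= r%:E * P D.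
Proof.
move=> mX FD Xr; have mD := Fm FD.
pose i j w := first_index (fun i => ball (x i) (j.+1%:R^-1)%R (X w)).
pose N j w := pickle (i j w, j).
have iX j w : B (N j w) (X w).
  rewrite /B base_ball_pickle.
  apply: (@first_indexP (fun i => ball (x i) (j.+1%:R^-1)%R (X w))).
  by apply: dx; rewrite invr_gt0.
have Fi j i0 : F [set w | i j w = i0].
  have Fb i1 : F [set w | ball (x i1) (j.+1%:R^-1)%R (X w)].
    by apply: mX; apply: sub_sigma_algebra; exact: ball_open.
  rewrite (_ : mkset _ = [set w |
    (ball (x i0) (j.+1%:R^-1)%R (X w) /\
      forall i1, (i1 < i0)%N -> ~ ball (x i1) (j.+1%:R^-1)%R (X w)) \/
    (i0 = 0%N /\ forall i1, ~ ball (x i1) (j.+1%:R^-1)%R (X w))]).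
    apply: (sigma_or HF); apply: (sigma_and HF) => //.
    - by apply: (sigma_all HF) => i1; apply: (sigma_imp HF) => _; exact: (sigma_not HF).
    - exact: (sigma_cst HF (i0 = 0%N)).
    - by apply: (sigma_all HF) => i1; exact: (sigma_not HF).
  by apply/seteqP; split=> w /= /first_indexE.
have comp_index (G : set_system Omega) (f : nat -> Omega -> \bar R) j :
    sigma_algebra setT G -> F `<=` G -> (forall n, emeas G (f n)) ->
    emeas G (fun w => f (N j w) w).
  move=> HG FG mf s; rewrite (_ : mkset _ = [set w | exists i0,
     i j w = i0 /\ f (pickle (i0, j)) w < s%:E]).
    apply: (sigma_ex HG) => i0; apply: (sigma_and HG); [exact/FG/Fi|exact: mf].
  apply/seteqP; split=> w /=; first by move=> ?; exists (i j w).
  by move=> [_ [<-]].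
have mqN j : measurable_fun D (fun w => q (N j w) w).
  apply: (emeas_measurable (@subset_refl _ measurable)) => //.
  exact: comp_index.
have meN j : measurable_fun D (fun w => e (N j w) w).
  by apply: (emeas_measurable Fm) => //; exact: comp_index.
have e0 n w : 0 <= e n w by have [] := qe n.
have int_qN j : \int[P]_(w in D) q (N j w) w = \int[P]_(w in D) e (N j w) w.
  (* [q n] and [e n] have equal integrals for a fixed [n], so [D] is cut along the values of the
     random index. *)
  have DE : D = \bigcup_i0 (D `&` [set w | i j w = i0]).
    by apply/seteqP; split=> [w Dw|w [i0 _ []]//]; exists (i j w).
  have FDi i0 : F (D `&` [set w | i j w = i0]) := sigma_and HF FD (Fi j i0).
  have tD : trivIset setT (fun i0 => D `&` [set w | i j w = i0]).
    by move=> i0 i1 _ _ [w [[_ /= <-] [_ /= <-]]].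
  rewrite [in LHS]DE [in RHS]DE !ge0_integral_bigcup//; rewrite -?DE//; last 2 first.
  - by move=> i0; exact: Fm.
  - by move=> i0; exact: Fm.
  apply: eq_eseriesr => i0 _.
  have [_ _ eqA] := qe (pickle (i0, j)).
  transitivity (\int[P]_(w in D `&` [set w | i j w = i0]) q (pickle (i0, j)) w).
    by apply: eq_integral => w /set_mem[_ /= <-].
  by rewrite -eqA//; apply: eq_integral => w /set_mem[_ /= <-].
have limq w : limn_einf (fun j => q (N j w) w) = h (X w) w.
  apply/eqP; rewrite eq_le; apply/andP; split.
    by apply: limn_einf_le => j; apply: ereal_inf_lbound; exists (X w).
  apply: limn_einf_ge => a ah.
  have /nbhs_ballP[c /= c0 ca] := open_nbhs_nbhs (conj (oh w a) ah).
  have [|j0 j0c] := @small_inv _ (c / 2)%R; first by rewrite divr_gt0.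
  exists j0 => j j0j; apply: le_ereal_inf_tmp => _ [z jz <-].
  apply/ltW/ca; have := iX j w; rewrite /B base_ball_pickle => jX.
  rewrite /B base_ball_pickle in jz.
  have := ball_triangle (ball_sym jX) jz; apply: le_ball.
  have : (j.+1%:R^-1 <= j0.+1%:R^-1 :> R)%R by rewrite lef_pV2 ?posrE// ler_nat ltnS.
  move=> /le_lt_trans/(_ j0c).
  have le_c (s : R) : (s < c / 2 -> s + s <= c)%R by lra.
  exact: le_c.
have -> : \int[P]_(w in D) h (X w) w =
    \int[P]_(w in D) limn_einf (fun j => q (N j w) w).
  by apply: eq_integral => w _; rewrite limq.
apply: le_trans (fatou P mD mqN (fun n w _ => q0 (N n w) w)) _.
apply: limn_einf_le => j; rewrite int_qN; apply: (integral_cst_le P mD (meN j)) => w Dw.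
by apply: le_trans (Xr w Dw); apply: ereal_sup_ubound; exists (N j w) => //; exact: iX.
Qed.

(** The selection is now made for [sup_integrand], so [k] has to be at least [s] wherever [X] falls:
    the bad event requires this on a whole ball. *)
Lemma cond_le_sup_integrand :
  \forall w \ae P, forall z, k z w <= sup_integrand B e z w.
Proof.
have os := sup_integrand_lsc e (@base_ball_open _ _ x).
have ms : inf_measurable F (sup_integrand B e).
  apply: normal_inf_measurable; apply: (sup_integrand_normal _ HF me dx pE).
  exact: base_ball_open.
have : \forall w \ae P, forall mnrs : (nat * nat) * (rat * rat),
    closure (B mnrs.1.1) `<=` B mnrs.1.2 -> (ratr mnrs.2.1 < ratr mnrs.2.2 :> R)%R ->
    ~ ((exists2 z, B mnrs.1.1 z & sup_integrand B e z w < (ratr mnrs.2.1)%:E) /\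
       ~ (exists2 z, B mnrs.1.2 z & k z w < (ratr mnrs.2.2)%:E)).
  apply: ae_forall_countable => -[[m n] [r s]] /=.
  have [mn|nmn] := pselect (closure (B m) `<=` B n); last exact: aeW.
  have [rs|nrs] := pselect (ratr r < ratr s :> R)%R; last exact: aeW.
  pose D := [set w | (exists2 z, B m z & sup_integrand B e z w < (ratr r)%:E) /\
    ~ (exists2 z, B n z & k z w < (ratr s)%:E)].
  have FD : F D.
    apply: (sigma_and HF); first exact/ms/base_ball_open.
    by apply: (sigma_not HF); exact/mk/base_ball_open.
  have mD := Fm FD.
  have [X mX XB] := ball_selection m (ratr r) os ms.
  have [mhX mkX] := comp_measurable mX FD.
  have PD : P D = 0.
    apply: (@null_of_lt_cst _ _ _ P D (ratr r) (ratr s)) => //.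
    apply: (@le_trans _ _ (\int[P]_(w in D) k (X w) w)).
      apply: integral_cst_ge => // w [/XB[/mn nX _] nk]; rewrite leNgt.
      by apply/negP => ks; apply: nk; exists (X w).
    rewrite kh//; apply: integral_le_sup_integrand => // w [/XB[_ ?] _]//.
  by exists D; split=> // w /= nw; apply: contrapT => nDw; apply: nw => _ _.
apply: filterS => w kw z; rewrite leNgt; apply/negP => /ereal_lt_rat[s /andP[ss sk]].
have [r /andP[sr rs]] := ereal_lt_rat ss.
have [n nz nk] := base_ballP dx (open_nbhs_nbhs (conj (ok w (ratr s)) sk)).
have [m mz mn] := base_ball_nbhs dx (open_nbhs_nbhs (conj (@base_ball_open _ _ x n) nz)).
apply: (kw ((m, n), (r, s))) => //=; split; first by exists z.
by move=> [y /nk/= sy ys]; have := lt_trans sy ys; rewrite ltxx.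
Qed.

Lemma cond_integrand_sup :
  \forall w \ae P, forall z, k z w = sup_integrand B e z w.
Proof.
apply: filterS2 sup_integrand_le_cond cond_le_sup_integrand => w le1 le2 z.
by apply/eqP; rewrite eq_le le1 le2.
Qed.

End cond_integrand_sup.

Lemma emeas_fine {R : realType} (S : pointedType) (G : set_system S) (f : S -> \bar R) :
  sigma_algebra setT G -> emeas G f -> emeas G (fun w => (fine (f w))%:E).
Proof.
move=> HG /(emeasP _ HG) mf; apply/(emeasP _ HG)/measurable_EFinP.
by apply: measurableT_comp => //; exact: fine_measurable.
Qed.

(** * Shifting and truncating integrands *)

Section shift.
Context {R : realType} {E : normedModType R} {S : pointedType}.
Variables (g : E -> S -> \bar R) (f : S -> R).

Lemma shift_lsc w : (forall a : R, open [set z | a%:E < g z w]) ->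
  forall a : R, open [set z | a%:E < g z w + (f w)%:E].
Proof.
move=> og a; rewrite (_ : mkset _ = [set z | (a - f w)%:E < g z w]); first exact: og.
by apply/seteqP; split=> z /=; rewrite EFinB lteBlDr.
Qed.

Lemma shift_inf_measurable (G : set_system S) : sigma_algebra setT G ->
  inf_measurable G g -> emeas G (EFin \o f) ->
  inf_measurable G (fun z w => g z w + (f w)%:E).
Proof.
move=> HG mg mf U r oU.
rewrite (_ : mkset _ = [set w | ereal_inf [set g z w | z in U] < r%:E - (f w)%:E]).
  apply: (emeas_lte2 HG); first exact: inf_measurable_emeas.
  by apply: emeasD => //; [exact: emeas_cst|exact: emeasN].
have lt_shift z w : (g z w + (f w)%:E < r%:E) = (g z w < r%:E - (f w)%:E).
  by rewrite lteBrDr.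
apply/seteqP; split=> w.
  move=> [z Uz]; rewrite lt_shift; apply: le_lt_trans.
  by apply: ereal_inf_lbound; exists z.
by move=> /ereal_inf_lt[_ [z Uz <-]]; rewrite -lt_shift; exists z.
Qed.

Lemma max0_lsc w : (forall a : R, open [set z | a%:E < g z w]) ->
  forall a : R, open [set z | a%:E < Order.max (g z w) 0].
Proof.
move=> og a; have [a0|a0] := boolP (a%:E < 0).
  rewrite (_ : mkset _ = setT); first exact: openT.
  by apply/seteqP; split=> z //= _; rewrite lt_max a0 orbT.
rewrite (_ : mkset _ = [set z | a%:E < g z w]); first exact: og.
by apply/seteqP; split=> z /=; rewrite lt_max (negbTE a0) orbF.
Qed.

Lemma max0_inf_measurable (G : set_system S) : sigma_algebra setT G ->
  inf_measurable G g -> inf_measurable G (fun z w => Order.max (g z w) 0).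
Proof.
move=> HG mg U r oU.
rewrite (_ : mkset _ = [set w | (0 < r)%R /\ exists2 z, U z & g z w < r%:E]).
  by apply: (sigma_and HG); [exact: (sigma_cst HG (0 < r)%R)|exact: mg].
apply/seteqP; split=> w /=.
  by move=> [z Uz]; rewrite gt_max lte_fin => /andP[? ?]; split=> //; exists z.
by move=> [r0 [z Uz gz]]; exists z => //; rewrite gt_max gz lte_fin.
Qed.

End shift.

Section cond_integrand_measurable.
Context {R : realType} {d : measure_display} {Omega : measurableType d}.
Variable P : probability Omega R.
Context {E : normedModType R}.
Variables (G F Xi : set_system Omega) (x : nat -> E).
Hypotheses (HG : sigma_algebra setT G) (HF : sigma_algebra setT F).
Hypotheses (HXi : sigma_algebra setT Xi) (GF : G `<=` F) (Fm : F `<=` measurable).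
Hypotheses (dx : dense_seq x) (pE : proper_space E).
Hypothesis versions : forall f : Omega -> \bar R, emeas measurable f ->
  (forall w, 0 <= f w) -> emeas Xi f -> exists Z, cond_version P G F f Z.
Variables (Q EQ : E -> Omega -> \bar R).
Hypotheses (nQ : normal_integrand measurable Q) (lbQ : lower_bounded P Q).
Hypotheses (mQ : inf_measurable Xi Q) (cQ : is_cond_integrand P F Q EQ).

Let Hm : sigma_algebra setT (@measurable d Omega).
Proof. exact: sigma_algebra_measurable. Qed.

(** The negative part of the infimum of [Q]. It is measurable for each sigma-algebra for which [Q]
    is, and dominated by the absolute value of any lower bound, hence integrable. [fine] matters
    only where the infimum is -oo, a null set. *)
Let M w : R := fine (Order.max (- ereal_inf [set Q z w | z in setT]) 0).

Let M_ge0 w : (0 <= M w)%R.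
Proof. by rewrite fine_ge0// le_max lexx orbT. Qed.

Let M_emeas (H : set_system Omega) : sigma_algebra setT H -> inf_measurable H Q ->
  emeas H (EFin \o M).
Proof.
move=> HH mHQ; apply: emeas_fine => //; apply: emeas_max => //; last exact: emeas_cst.
by apply: emeasN => //; apply: inf_measurable_emeas => //; exact: openT.
Qed.

Let measurable_M : measurable_fun setT (EFin \o M).
Proof. exact/emeas_measurable_fun/(M_emeas Hm)/(normal_inf_measurable nQ). Qed.

Let Q_ge_M : \forall w \ae P, forall z, - (M w)%:E <= Q z w.
Proof.
have [m _ mQ0] := lbQ; apply: filterS mQ0 => w mQ0 z.
have mI : (m w)%:E <= ereal_inf [set Q z w | z in setT].
  by apply: le_ereal_inf_tmp => _ [y _ <-].
rewrite /M fineK; last first.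
  rewrite ge0_fin_numE ?le_max ?lexx ?orbT// gt_max ltry andbT.
  by rewrite lteNl; apply: lt_le_trans mI; rewrite ltNyr.
rewrite leeNl le_max leeN2; apply/orP; left.
by apply: ereal_inf_lbound; exists z.
Qed.

Let M_lty : \int[P]_w (M w)%:E < +oo.
Proof.
have [m im mQ0] := lbQ.
have := integrableP _ _ _ im => -[mm im_lty].
apply: le_lt_trans im_lty; apply: ae_ge0_le_integral => //.
- by move=> w _; rewrite lee_fin.
- exact: measurableT_comp.
apply: filterS mQ0 => w mQ0 _ /=.
have mI : (m w)%:E <= ereal_inf [set Q z w | z in setT].
  by apply: le_ereal_inf_tmp => _ [y _ <-].
rewrite /M fineK; last first.
  rewrite ge0_fin_numE ?le_max ?lexx ?orbT// gt_max ltry andbT.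
  by rewrite lteNl; apply: lt_le_trans mI; rewrite ltNyr.
rewrite ge_max lee_fin normr_ge0 andbT leeNl.
by apply: le_trans mI; rewrite -EFinN lee_fin lerNl -normrN ler_norm.
Qed.

(** The truncation acts on a null set only; it makes [h] nonnegative for every [w]. *)
Let h z w := Order.max (Q z w + (M w)%:E) 0.

Let h_lsc w (a : R) : open [set z | a%:E < h z w].
Proof.
apply: (@max0_lsc _ _ _ (fun z w => Q z w + (M w)%:E)) => b; apply: shift_lsc.
by apply/closed_epiP; have [] := nQ.
Qed.

Let h_inf_measurable (H : set_system Omega) : sigma_algebra setT H ->
  inf_measurable H Q -> inf_measurable H h.
Proof.
move=> HH mHQ; apply: max0_inf_measurable => //.
by apply: shift_inf_measurable => //; exact: M_emeas.
Qed.

(** [EQ] plus a version of [M] has the integrals of [h] along every selection, so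
    [cond_integrand_sup] represents it by [G]-measurable functions. Subtracting the version of [M],
    itself [G]-measurable, returns to [EQ]. *)
Lemma cond_integrand_inf_measurable (U : set E) (r : R) : open U ->
  exists2 A, G A & \forall w \ae P, (exists2 z, U z & EQ z w < r%:E) <-> A w.
Proof.
move=> oU; have mQm := normal_inf_measurable nQ.
have oQ w : forall a : R, open [set z | a%:E < Q z w] by apply/closed_epiP; have [] := nQ.
have [nEQ EQ_cond] := cQ.
have oEQ w : forall a : R, open [set z | a%:E < EQ z w].
  by apply/closed_epiP; have [] := nEQ.
have h_ge0 z w : 0 <= h z w by rewrite le_max lexx orbT.
have [Z [mZ Z0 ZM]] := versions (M_emeas Hm mQm) (fun w => M_ge0 w) (M_emeas HXi mQ).
pose Zm w : R := fine (Z w).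
have Zm0 w : (0 <= Zm w)%R by exact: fine_ge0.
have mZm : emeas G (EFin \o Zm) by exact: emeas_fine.
have ZmZ : \forall w \ae P, (Zm w)%:E = Z w.
  have iZ : P.-integrable setT Z.
    apply/integrableP; split.
      exact/emeas_measurable_fun/(emeas_sub (subset_trans GF Fm)).
    under eq_integral do rewrite gee0_abs//.
    by rewrite ZM//; exact: sigmaT.
  have := integrable_ae measurableT iZ; apply: filterS => w /(_ I) Zf.
  by rewrite /Zm fineK.
have ZmM A : F A -> \int[P]_(w in A) (Zm w)%:E = \int[P]_(w in A) (M w)%:E.
  move=> FA; rewrite -ZM//; apply: ae_eq_integral; first exact: Fm.
  - by apply: (emeas_measurable (subset_trans GF Fm)) => //; exact: Fm.
  - by apply: (emeas_measurable (subset_trans GF Fm)) => //; exact: Fm.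
  by apply: filterS ZmZ => w.
have /(_ _)/cid-/all_sig[e qe] (n : nat) : exists Z, cond_version P G F
    (fun w => ereal_inf [set h z w | z in base_ball x n]) Z.
  apply: versions.
  - by apply: inf_measurable_emeas; [exact: base_ball_open|exact: h_inf_measurable].
  - by move=> w; apply: le_ereal_inf_tmp => _ [z _ <-].
  - by apply: inf_measurable_emeas; [exact: base_ball_open|exact: h_inf_measurable].
pose k z w := EQ z w + (Zm w)%:E.
have M_ltyA A : measurable A -> \int[P]_(w in A) (M w)%:E < +oo.
  move=> mA; apply: le_lt_trans M_lty; apply: ge0_subset_integral => //.
  by move=> w _; rewrite lee_fin.
have kh X : measurable_wrt F X -> forall A, F A ->
    \int[P]_(w in A) k (X w) w = \int[P]_(w in A) h (X w) w.
  move=> mX A FA; have mA := Fm FA.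
  have mXm : measurable_wrt measurable X by move=> C bC; exact/Fm/mX.
  have mQX : measurable_fun setT (fun w => Q (X w) w).
    exact/emeas_measurable_fun/(inf_measurable_comp Hm dx).
  have mEQX : measurable_fun setT (fun w => EQ (X w) w).
    apply/emeas_measurable_fun/(emeas_sub Fm)/(inf_measurable_comp HF dx) => //.
    exact: normal_inf_measurable.
  have [_ intX] := EQ_cond X mX.
  have QXn D : measurable D -> \int[P]_(w in D) (fun w => Q (X w) w)^\- w < +oo.
    move=> mD; apply: le_lt_trans (M_ltyA D mD); apply: ae_ge0_le_integral => //.
    - exact/measurable_funeneg/(measurable_funS measurableT).
    - by move=> w _; rewrite lee_fin.
    - exact: (measurable_funS measurableT).
    apply: filterS Q_ge_M => w QM _; rewrite funenegE ge_max lee_fin M_ge0 andbT.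
    by rewrite leeNl.
  (* Otherwise the integral of [EQ] along [X] would be -oo by the convention on [+oo - +oo], whereas
     that of [Q] is not, its negative part being dominated by [M]. *)
  have EQXn : \int[P]_w (fun w => EQ (X w) w)^\- w < +oo.
    have := intX _ (sigmaT HF); rewrite integralE [RHS]integralE => EQ_Q.
    rewrite ltey; apply/eqP => EQn; move: EQ_Q; rewrite EQn addeNy.
    have := QXn _ measurableT.
    have : 0 <= \int[P]_w (fun w => Q (X w) w)^\- w by exact: integral_ge0.
    have : 0 <= \int[P]_w (fun w => Q (X w) w)^\+ w by exact: integral_ge0.
    by move: (integral P _ _^\+) (integral P _ _^\-) => [a| |] [b| |].
  rewrite integralD_nonneg//; last 4 first.
  - exact: (measurable_funS measurableT).
  - apply: le_lt_trans EQXn; apply: ge0_subset_integral => //.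
    exact: measurable_funeneg.
  - exact: (emeas_measurable (subset_trans GF Fm)).
  - by rewrite ZmM//; exact: M_ltyA.
  rewrite ZmM// intX// -integralD_nonneg//; last 4 first.
  - exact: (measurable_funS measurableT).
  - exact: QXn.
  - exact: (measurable_funS measurableT).
  - exact: M_ltyA.
  apply: ae_eq_integral => //.
  - apply: emeasurable_funD; exact: (measurable_funS measurableT).
  - apply: (emeas_measurable (@subset_refl _ measurable)) => //.
    by apply: (inf_measurable_comp Hm dx) => //; exact: h_inf_measurable.
  apply: filterS Q_ge_M => w QM _; apply/esym/max_idPl.
  by rewrite -leeBlDr// sub0e.
have ok w (a : R) : open [set z | a%:E < k z w] by exact: shift_lsc.
have mk : inf_measurable F k.
  apply: shift_inf_measurable => //; first exact: normal_inf_measurable.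
  exact: emeas_sub mZm.
have qeF n : cond_version P F F
    (fun w => ereal_inf [set h z w | z in base_ball x n]) (e n).
  by have [me e0 eq] := qe n; split=> //; exact: emeas_sub me.
have := cond_integrand_sup HF Fm dx pE h_lsc (h_inf_measurable Hm mQm) h_ge0 ok mk kh qeF.
move=> ksup.
exists [set w | exists2 z, U z &
    sup_integrand (base_ball x) e z w + (- Zm w)%:E < r%:E].
  apply: (@shift_inf_measurable _ _ _ _ (fun w => - Zm w)%R G HG) => //.
    apply: normal_inf_measurable; apply: sup_integrand_normal => //.
    - exact: base_ball_open.
    - by move=> n; have [] := qe n.
    - exact: dx.
  exact: (emeasN HG mZm).
apply: filterS ksup => w ksup.
have kE z : sup_integrand (base_ball x) e z w + (- Zm w)%:E = EQ z w.
  by rewrite -ksup /k EFinN addeK.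
by split=> -[z Uz] zr; exists z => //; rewrite ?kE// -kE.
Qed.

End cond_integrand_measurable.

(** * The Bellman recursion *)

Section dynamics.
Context {R : realType} {d : measure_display} {Omega : measurableType d}.
Variables (N Mb Ma : nat).
Variables (A : nat -> Omega -> 'M[R]_(N, N)) (Bb : nat -> Omega -> 'M[R]_(N, Mb)).
Variables (Ba : nat -> Omega -> 'M[R]_(N, Ma)) (W : nat -> Omega -> 'cV[R]_N).
Variable t : nat.

Lemma dynamics_continuous w :
  continuous (fun z : 'cV[R]_N * 'cV[R]_Mb * 'cV[R]_Ma =>
    dynamics A Bb Ba W t z.1.1 z.1.2 z.2 w).
Proof.
move=> z; apply: cvgD; last exact: cvg_cst.
apply: cvgD; [apply: cvgD|].
- apply: (cvg_comp (fun z : 'cV[R]_N * 'cV[R]_Mb * 'cV[R]_Ma => z.1.1)).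
    by apply: (cvg_comp fst fst); exact: cvg_fst.
  exact: mulmx_continuous.
- apply: (cvg_comp (fun z : 'cV[R]_N * 'cV[R]_Mb * 'cV[R]_Ma => z.1.2)).
    by apply: (cvg_comp fst snd); [exact: cvg_fst|exact: cvg_snd].
  exact: mulmx_continuous.
- apply: (cvg_comp snd); first exact: cvg_snd.
  exact: mulmx_continuous.
Qed.

Lemma dynamics_measurable (G : set_system Omega) x ub ua (u : 'cV[R]_N) (e : R) :
  sigma_algebra setT G -> measurable_wrt G (A t.+1) -> measurable_wrt G (Bb t.+1) ->
  measurable_wrt G (Ba t.+1) -> measurable_wrt G (W t.+1) ->
  G [set w | ball u e (dynamics A Bb Ba W t x ub ua w)].
Proof.
move=> HG mA mB mC mW; apply: (ball_mx_measurable HG) => i j.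
rewrite /dynamics; under eq_fun do rewrite !mxE.
apply: measurable_funD; last exact: measurable_wrt_coord.
by apply: measurable_funD; [apply: measurable_funD|]; apply: measurable_sum => k;
  apply: measurable_funM => //; exact: measurable_wrt_coord.
Qed.

End dynamics.

Section bellman_step.
Context {R : realType} {d : measure_display} {Omega : measurableType d}.
Variable P : probability Omega R.
Variables (T N Mb Ma : nat) (F : nat -> set_system Omega).
Hypothesis HF : filtration T F.
Variable L : nat -> 'cV[R]_N * 'cV[R]_Mb * 'cV[R]_Ma -> Omega -> \bar R.
Hypothesis HL : forall t, (t < T)%N -> lb_convex_normal_integrand P (F t.+1) (L t).
Variable J : 'cV[R]_N -> Omega -> \bar R.
Variables (A : nat -> Omega -> 'M[R]_(N, N)) (Bb : nat -> Omega -> 'M[R]_(N, Mb)).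
Variables (Ba : nat -> Omega -> 'M[R]_(N, Ma)) (W : nat -> Omega -> 'cV[R]_N).
Variable Jt : nat -> 'cV[R]_N -> Omega -> \bar R.
Variable Qt : nat -> 'cV[R]_N * 'cV[R]_Mb -> Omega -> \bar R.
Hypothesis Hsol :
  lb_convex_normal_bellman_solution P T F L (dynamics A Bb Ba W) J Jt Qt.
Variables (dtheta deta : nat -> nat).
Variable theta : forall t : nat, Omega -> 'cV[R]_(dtheta t).
Variable eta : forall t : nat, Omega -> 'cV[R]_(deta t).
Hypotheses (Htheta_adapted : adapted T F theta) (Htheta_markov : markov P T F theta).
Hypotheses (Heta_adapted : adapted T F eta)
           (Heta_nonant : nonanticipative_noise P T F theta eta).

(** Three passages: from [theta t.+1] to [xi] by projection, through the infimum over [ua] inside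
    [ae_sigma P xi], and from [xi] to [theta t] by conditioning on [F t]. *)
Lemma bellman_step t : (t < T)%N ->
  (let xi := fun w => (theta t w, theta t.+1 w, eta t.+1 w) in
   [/\ integrand_depends_through P (L t) xi,
       rv_depends_through P (A t.+1) xi,
       rv_depends_through P (Bb t.+1) xi,
       rv_depends_through P (Ba t.+1) xi &
       rv_depends_through P (W t.+1) xi]) ->
  integrand_depends_through P (Jt t.+1) (theta t.+1) ->
  integrand_depends_through P (Jt t) (theta t).
Proof.
move=> tT; set xi := fun w => _; move=> -[/= dL dA dBb dBa dW] dJ.
have [Fs Fm _] := HF; have t_T := ltnW tT.
have [HJt HQt [EQ [HEQ Hbell]]] := Hsol.
have [nL _ [mL _ L_ge]] := HL tT.
have [nJ1 _ [m1 _ J1_ge]] := HJt t.+1 tT.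
have [nJ _ _] := HJt t t_T.
have [nQ _ lbQ] := HQt t tT.
have [x dx] := @dense_seq_mx R N 1; have [y dy] := @dense_seq_mx R Mb 1.
have [xy dxy] : exists z : nat -> 'cV[R]_N * 'cV[R]_Mb, dense_seq z.
  by apply: dense_seq_pair; [exists x|exists y].
have [xyz dxyz] : exists z : nat -> 'cV[R]_N * 'cV[R]_Mb * 'cV[R]_Ma, dense_seq z.
  by apply: dense_seq_pair; [exists xy|exact: dense_seq_mx].
have pxy : proper_space ('cV[R]_N * 'cV[R]_Mb)%type.
  by apply: proper_pair; exact: proper_cV.
have pxyz : proper_space ('cV[R]_N * 'cV[R]_Mb * 'cV[R]_Ma)%type.
  by apply: proper_pair => //; exact: proper_cV.
pose Xi := ae_sigma P xi; have HXi : sigma_algebra setT Xi := ae_sigmaP P xi.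
pose f z w := dynamics A Bb Ba W t z.1.1 z.1.2 z.2 w.
pose nonNy := [set w | (forall z, -oo < L t z w) /\ forall z, -oo < Jt t.+1 z w].
have nonNy_ae : \forall w \ae P, nonNy w.
  apply: filterS2 L_ge J1_ge => w Lw Jw.
  by split=> z; [apply: lt_le_trans (Lw z)|apply: lt_le_trans (Jw z)]; rewrite ltNyr.
(* Null modifications are built into [Xi]: a set that contains almost every [w] belongs to it, with
   the whole space as Borel set. *)
have XiN : Xi nonNy.
  exists setT; first exact: (sigmaT (@borel_sigma _)).
  by apply: filterS nonNy_ae => w.
have mJ1 : inf_measurable Xi (Jt t.+1).
  move=> U r oU; apply: (@ae_sigma_comp _ _ _ P _ _ xi (fun s => s.1.2)).
    apply: continuous_measurable_wrt => s.
    by apply: (cvg_comp fst snd); [exact: cvg_fst|exact: cvg_snd].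
  exact: (depends_inf_measurable dJ).
have mf z u (e : R) : Xi [set w | ball u e (f z w)].
  by apply: (dynamics_measurable _ _ _ _ _ HXi); exact: rv_depends_measurable_wrt.
have mQ : inf_measurable Xi (Qt t).
  move=> U r oU.
  (* [Qt t] goes below [r] over [U] exactly when the sum does so over the cylinder on [U]. *)
  have oU' : open [set z : 'cV[R]_N * 'cV[R]_Mb * 'cV[R]_Ma | U z.1].
    by apply: (open_comp _ oU) => z _; exact: cvg_fst.
  have oL w (a : R) : open [set z | a%:E < L t z w].
    by have [/(_ w)/closed_epiP] := nL; exact.
  have oJ w (a : R) : open [set z | a%:E < Jt t.+1 z w].
    by have [/(_ w)/closed_epiP] := nJ1; exact.
  have XiU := @sum_inf_measurable _ _ _ _ Xi nonNy _ _ (L t) (Jt t.+1) f HXi XiN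
    dxyz dx pxyz oL oJ (depends_inf_measurable dL) mJ1
    (@dynamics_continuous _ _ _ N Mb Ma A Bb Ba W t) mf (fun w Nw => Nw.1)
    (fun w Nw => Nw.2) _ r oU'.
  apply: ae_preimage_ae XiU _.
  apply: filterS2 nonNy_ae Hbell => w Nw [_ Qw _] /=; split.
    move=> [_ [[[z1 z2] ua] /= Uz zr]]; exists (z1, z2) => //; rewrite Qw//.
    by apply: le_lt_trans zr; apply: ereal_inf_lbound; exists ua.
  move=> [[z1 z2] Uz]; rewrite Qw// => /ereal_inf_lt[_ [ua _ <-] zr].
  by split=> //; exists (z1, z2, ua).
have mtheta : measurable_wrt (F t) (theta t) := Htheta_adapted t_T.
have HFt := Fs t t_T; have Fmt := Fm t t_T.
have cxi B : borel _ B -> cond_probable P (sigma_of (theta t)) (F t) (xi @^-1` B).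
  apply: cond_probable_markov => //; try exact: dense_seq_mx.
  - by move=> C bC; exact/(Fm _ tT)/Htheta_adapted.
  - by move=> C bC; exact/(Fm _ tT)/Heta_adapted.
  - exact: Htheta_markov.
  - exact: Heta_nonant.
have Hu : sigma_algebra setT (sigma_of (theta t)) := sigma_of_sigma (theta t).
have Fu := sigma_of_sub mtheta.
have mxi : measurable_wrt measurable xi by move=> B /cxi[].
have EQm := cond_integrand_inf_measurable Hu HFt HXi Fu Fmt dxy pxy
  (fun f => @cond_version_ae _ _ _ P _ _ Hu Fu Fmt _ _ mxi cxi f) nQ lbQ mQ (HEQ t tT).
apply: (inf_measurable_depends dx (@proper_cV R N)).
  by move=> w; apply/closed_epiP; have [] := nJ.
move=> U r oU.
have oU' : open [set z : 'cV[R]_N * 'cV[R]_Mb | U z.1].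
  by apply: (open_comp _ oU) => z _; exact: cvg_fst.
have [_ [B bB <-] BE] := EQm _ r oU'.
exists B => //; apply: filterS2 BE Hbell => w BE [_ _ Jw].
rewrite setTI in BE; apply: iff_trans BE; split => /=.
  move=> [z1 Uz]; rewrite Jw// => /ereal_inf_lt[_ [ub _ <-] zr].
  by exists (z1, ub).
move=> [[z1 ub] /= Uz zr]; exists z1 => //; rewrite Jw//.
by apply: le_lt_trans zr; apply: ereal_inf_lbound; exists ub.
Qed.

Lemma bellman_depends :
  (forall t, (1 <= t <= T)%N ->
     let xi := fun w => (theta t.-1 w, theta t w, eta t w) in
     [/\ integrand_depends_through P (L t.-1) xi,
         rv_depends_through P (A t) xi,
         rv_depends_through P (Bb t) xi,
         rv_depends_through P (Ba t) xi &
         rv_depends_through P (W t) xi]) ->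
  integrand_depends_through P J (theta T) ->
  forall t, (t <= T)%N -> integrand_depends_through P (Jt t) (theta t).
Proof.
move=> Hdep [H nH JH].
have step k : (k <= T)%N -> integrand_depends_through P (Jt (T - k)%N) (theta (T - k)%N).
  elim: k => [_|k IHk kT].
    rewrite subn0; exists H => //; have [_ _ [EQ [_ Hbell]]] := Hsol.
    by apply: filterS2 JH Hbell => w JH [JtJ _ _] x; rewrite JtJ JH.
  have tT : (T - k.+1 < T)%N by rewrite ltn_subrL (leq_trans _ kT).
  have tS : (T - k.+1).+1 = (T - k)%N by rewrite subnSK.
  apply: bellman_step => //; last by rewrite tS; exact/IHk/ltnW.
  exact: (Hdep (T - k.+1).+1).
by move=> t tT; rewrite -(subKn tT); apply: step; exact: leq_subr.
Qed.

End bellman_step.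

(** * Composition, constant processes and deterministic integrands *)

Section depends_comp.
Context {R : realType} {d : measure_display} {Omega : measurableType d}.
Variable P : probability Omega R.
Variables (D D' : topologicalType) (xi : Omega -> D') (phi : D' -> D).
Hypothesis mphi : measurable_wrt (borel D') phi.

Lemma rv_depends_comp (E : topologicalType) (C : Omega -> E) :
  rv_depends_through P C (phi \o xi) -> rv_depends_through P C xi.
Proof. by move=> [Chat mC CC]; exists (Chat \o phi) => // B /mC/mphi. Qed.

Lemma integrand_depends_comp (E : topologicalType) (h : E -> Omega -> \bar R) :
  integrand_depends_through P h (phi \o xi) -> integrand_depends_through P h xi.
Proof.
move=> [H [cH mH] hH]; exists (fun z s => H z (phi s)) => //.
by split=> [s|O oO]; [exact: cH|exact: (mphi (mH O oO))].
Qed.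

End depends_comp.

Section constant_process.
Context {R : realType} {d : measure_display} {Omega : measurableType d}.
Variable P : probability Omega R.

Lemma constant_measurable (E : topologicalType) (G : set_system Omega) (c : E) :
  sigma_algebra setT G -> measurable_wrt G (cst c).
Proof. by move=> HG B _; exact: (sigma_cst HG (B c)). Qed.

Lemma constant_markov (T : nat) (F : nat -> set_system Omega)
    (E : nat -> topologicalType) (c : forall t, E t) :
  filtration T F -> markov P T F (fun t (_ : Omega) => c t).
Proof.
move=> [Fs _ _] t tT B _.
exists (EFin \o \1_((fun _ : Omega => c t.+1) @^-1` B)).
have -> : EFin \o \1_((fun _ : Omega => c t.+1) @^-1` B) =
    cst ((c t.+1 \in B)%:R%:E : \bar R).
  by apply/funext => w /=; rewrite indicE.
split; split=> //; apply: constant_measurable; last exact/Fs/ltnW.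
exact/sigma_algebra_preimage/borel_sigma.
Qed.

(** The function [g] is replaced by [h] at one good [w0], whose epigraph is known to be closed. Such
    a point exists because [P] has positive mass. *)
Lemma deterministic_depends (E D : topologicalType) (G : set_system Omega)
    (h : E -> Omega -> \bar R) (xi : Omega -> D) :
  normal_integrand G h -> deterministic_integrand P h ->
  integrand_depends_through P h xi.
Proof.
move=> [ch _] [g hg].
have PT : (0 < P [set: Omega])%E by rewrite probability_setT.
have [w0 hw0] := @filter_ex _ _ (ae_properfilter_algebraOfSetsType PT) _ hg.
exists (fun z _ => h z w0); last by apply: filterS hg => w hg z; rewrite hg hw0.
split=> [_|O _]; first exact: ch.
exact: (sigma_cst (@borel_sigma D) (epi (h ^~ w0) `&` O !=set0)).
Qed.

Lemma depends_deterministic (E D : topologicalType) (h : E -> Omega -> \bar R) (c : D) :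
  integrand_depends_through P h (cst c) -> deterministic_integrand P h.
Proof. by move=> [H _ hH]; exists (H ^~ c). Qed.

End constant_process.

Theorem theorem4
  (R : realType) (d : measure_display) (Omega : measurableType d)
  (P : probability Omega R)
  (T N Mb Ma : nat) (F : nat -> set_system Omega)
  (HF : filtration T F)
  (HF0 : forall A, F 0%N A -> P A = 0 \/ P A = 1)
  (L : nat -> 'cV[R]_N * 'cV[R]_Mb * 'cV[R]_Ma -> Omega -> \bar R)
  (HL : forall t, (t < T)%N -> lb_convex_normal_integrand P (F t.+1) (L t))
  (J : 'cV[R]_N -> Omega -> \bar R)
  (HJ : lb_convex_normal_integrand P (F T) J)
  (A : nat -> Omega -> 'M[R]_(N, N)) (Bb : nat -> Omega -> 'M[R]_(N, Mb))
  (Ba : nat -> Omega -> 'M[R]_(N, Ma)) (W : nat -> Omega -> 'cV[R]_N)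
  (HA : forall t, (t < T)%N -> measurable_wrt (F t.+1) (A t.+1))
  (HBb : forall t, (t < T)%N -> measurable_wrt (F t.+1) (Bb t.+1))
  (HBa : forall t, (t < T)%N -> measurable_wrt (F t.+1) (Ba t.+1))
  (HW : forall t, (t < T)%N -> measurable_wrt (F t.+1) (W t.+1))
  (Hlin : forall t, (1 <= t <= T)%N -> \forall w \ae P,
     linear_set [set u : 'cV[R]_Ma |
       recession (fun z => L t.-1 z w) (0%R, 0%R, u) <= 0 /\
       Ba t w *m u = 0%R])
  (Jt : nat -> 'cV[R]_N -> Omega -> \bar R)
  (Qt : nat -> 'cV[R]_N * 'cV[R]_Mb -> Omega -> \bar R)
  (Hsol : lb_convex_normal_bellman_solution P T F L
            (dynamics A Bb Ba W) J Jt Qt)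
  (dtheta deta : nat -> nat)
  (theta : forall t : nat, Omega -> 'cV[R]_(dtheta t))
  (eta : forall t : nat, Omega -> 'cV[R]_(deta t))
  (Htheta_adapted : adapted T F theta)
  (Htheta_markov : markov P T F theta)
  (Heta_adapted : adapted T F eta)
  (Heta_indep : independent_noise P T theta eta)
  (Heta_nonant : nonanticipative_noise P T F theta eta)
  (Hdep : forall t, (1 <= t <= T)%N ->
     let xi := fun w => (theta t.-1 w, theta t w, eta t w) in
     [/\ integrand_depends_through P (L t.-1) xi,
         rv_depends_through P (A t) xi,
         rv_depends_through P (Bb t) xi,
         rv_depends_through P (Ba t) xi &
         rv_depends_through P (W t) xi]) :
  (integrand_depends_through P J (theta T) ->
   forall t, (t <= T)%N -> integrand_depends_through P (Jt t) (theta t)) /\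
  ((forall t, (1 <= t <= T)%N ->
     [/\ integrand_depends_through P (L t.-1) (eta t),
         rv_depends_through P (A t) (eta t),
         rv_depends_through P (Bb t) (eta t),
         rv_depends_through P (Ba t) (eta t) &
         rv_depends_through P (W t) (eta t)]) ->
   deterministic_integrand P J ->
   forall t, (t <= T)%N -> deterministic_integrand P (Jt t)).
Proof.
split=> [HJdep|Hdep' HJdet t tT].
  exact: (bellman_depends HF HL Hsol Htheta_adapted Htheta_markov Heta_adapted
    Heta_nonant Hdep HJdep).
have [Fs Fm _] := HF.
(* Dependence through a process with values in the zero-dimensional space is dependence on
   nothing. *)
pose c (s : nat) : Omega -> 'cV[R]_0 := cst 0%R.
suff : integrand_depends_through P (Jt t) (c t) by exact: depends_deterministic.
apply: (bellman_depends (dtheta := fun=> 0%N) (theta := c) (eta := eta) HF HL Hsol) => //.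
- by move=> s sT; apply: constant_measurable; exact: Fs.
- exact: constant_markov.
(* Events generated by a constant are trivial, so joining them to [F s] stays within the
   sigma-algebra of the given noise condition. *)
- move=> s sT B C sB sC; apply: (Heta_nonant s sT) => //; move: C sC.
  apply: smallest_sub; first exact: smallest_sigma_algebra.
  move=> K [FK|[V bV <-]]; apply: sub_sigma_algebra; left => //.
  have /constant_measurable mc := Fs s (ltnW sT).
  by rewrite setTI; exact: mc.
- move=> s sT /=; have [dL dA dB dC dW] := Hdep' s sT.
  have msnd : measurable_wrt (borel ('cV[R]_0 * 'cV[R]_0 * 'cV[R]_(deta s))%type) snd.
    by apply: continuous_measurable_wrt => z; exact: cvg_snd.
  by split; [apply: (integrand_depends_comp msnd)|apply: (rv_depends_comp msnd)..].
- by case: HJ => nJ _ _; exact: deterministic_depends nJ HJdet.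
Qed.
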